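(* Let $M=r^a$, where $r$ is a prime and $a\geq 1$, and let $q$ be a prime power with $(q,M)=1$. Then, as formal power series in $u$, $$1+\sum_{n=1}^{\infty}c(n,q,M)\,u^n=\prod_{j=1}^{\infty}\prod_{i=0}^{a}\prod_{d\geq 1}(1-u^{jr^id})^{-N_M^i(q,d)}.$$
   Context: $\mathrm{GL}(n,q)$ is the group of invertible $n\times n$ matrices over the field $\mathbb F_q$ with $q$ elements. $c(n,q,M)$ is the number of conjugacy classes of $\mathrm{GL}(n,q)$ contained in the image of the power map $\mathrm{GL}(n,q)\to\mathrm{GL}(n,q)$, $x\mapsto x^M$. $\Phi$ is the set of all monic irreducible polynomials of degree $\geq 1$ over $\mathbb F_q$ other than the polynomial $x$. For $M=r^a$: $N_M^0(q,d)$ is the number of $f\in\Phi$ of degree $d$ such that $f(x^M)$ has an irreducible factor of degree $d$; for $1\leq i\leq a$, $N_M^i(q,d)$ is the number of $f\in\Phi$ of degree $d$ such that all irreducible factors of $f(x^M)$ over $\mathbb F_q$ have degree $dr^i$. *)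

(* Defs.v *)
From HB Require Import structures.
From mathcomp Require Import all_boot all_order all_fingroup all_algebra.
From mathcomp Require Import boolp classical_sets.

Set Implicit Arguments.
Unset Strict Implicit.
Unset Printing Implicit Defensive.

Import GRing.Theory.
Local Open Scope ring_scope.

Record fps (R : Type) := Fps { coefs : nat -> R }.

HB.instance Definition _ (R : Type) := gen_eqMixin (fps R).
HB.instance Definition _ (R : Type) := gen_choiceMixin (fps R).

Lemma fpsP (R : Type) (f g : fps R) : coefs f =1 coefs g -> f = g.
Proof. by case: f g => [f] [g] /= /funext ->. Qed.

Section FpsRing.
Variable R : comNzRingType.
Implicit Types f g h : fps R.

Definition fps_add f g := Fps (fun n => coefs f n + coefs g n).
Definition fps_opp f := Fps (fun n => - coefs f n).
Definition fps_zero : fps R := Fps (fun=> 0).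

Fact fps_addA : associative fps_add.
Proof. by move=> f g h; apply: fpsP => n /=; rewrite addrA. Qed.
Fact fps_addC : commutative fps_add.
Proof. by move=> f g; apply: fpsP => n /=; rewrite addrC. Qed.
Fact fps_add0 : left_id fps_zero fps_add.
Proof. by move=> f; apply: fpsP => n /=; rewrite add0r. Qed.
Fact fps_addN : left_inverse fps_zero fps_opp fps_add.
Proof. by move=> f; apply: fpsP => n /=; rewrite addNr. Qed.

HB.instance Definition _ := GRing.isZmodule.Build (fps R)
  fps_addA fps_addC fps_add0 fps_addN.

Definition fps_one : fps R := Fps (fun n => (n == 0%N)%:R).
Definition fps_mul f g :=
  Fps (fun n => \sum_(i < n.+1) coefs f i * coefs g (n - i)).

Let trunc m f : {poly R} := \poly_(i < m) coefs f i.

Let coef_trunc m f n : (n < m)%N -> (trunc m f)`_n = coefs f n.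
Proof. by move=> ltnm; rewrite coef_poly ltnm. Qed.

Let coefs_mul m f g n : (n < m)%N ->
  coefs (fps_mul f g) n = (trunc m f * trunc m g)`_n.
Proof.
move=> ltnm; rewrite coefM; apply: eq_bigr => i _.
rewrite !coef_trunc //; first exact: leq_ltn_trans (leq_subr _ _) ltnm.
exact: leq_trans (ltn_ord i) ltnm.
Qed.

Fact fps_mulC : commutative fps_mul.
Proof.
move=> f g; apply: fpsP => n.
by rewrite !(@coefs_mul n.+1) // mulrC.
Qed.

Fact fps_mulA : associative fps_mul.
Proof.
move=> f g h; apply: fpsP => n.
transitivity (trunc n.+1 f * (trunc n.+1 g * trunc n.+1 h))`_n.
  rewrite coefM; apply: eq_bigr => i _.
  by rewrite coef_trunc // (@coefs_mul n.+1) // ltnS leq_subr.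
rewrite mulrA coefM; apply: eq_bigr => i _.
by rewrite [in RHS](@coefs_mul n.+1) // coef_trunc // ltnS leq_subr.
Qed.

Fact fps_mul1 : left_id fps_one fps_mul.
Proof.
move=> f; apply: fpsP => n /=.
by rewrite big_ord_recl big1 ?addr0 ?mul1r ?subn0 // => i _; rewrite mul0r.
Qed.

Fact fps_mulD : left_distributive fps_mul fps_add.
Proof.
move=> f g h; apply: fpsP => n /=; rewrite -big_split /=.
by apply: eq_bigr => i _; rewrite mulrDl.
Qed.

Fact fps_one_neq0 : fps_one != fps_zero.
Proof. by apply/eqP => /(congr1 (fun f => coefs f 0)) /eqP; rewrite oner_eq0. Qed.

HB.instance Definition _ := GRing.Zmodule_isComNzRing.Build (fps R)
  fps_mulA fps_mulC fps_mul1 fps_mulD fps_one_neq0.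

Definition fps_unit : pred (fps R) := fun f => `[< exists g, g * f = 1 >].
Definition fps_inv f := xget f (fun g => g * f = 1).

Fact fps_mulVf : {in fps_unit, left_inverse 1 fps_inv *%R}.
Proof. by move=> f /asboolP; apply: xgetPex. Qed.
Fact fps_unitP f g : g * f = 1 -> fps_unit f.
Proof. by move=> gf; apply/asboolP; exists g. Qed.
Fact fps_inv_out : {in [predC fps_unit], fps_inv =1 id}.
Proof.
move=> f /asboolPn nf; apply: xgetPN => g gf.
by apply: nf; exists g.
Qed.

HB.instance Definition _ := GRing.ComNzRing_hasMulInverse.Build (fps R)
  fps_mulVf fps_unitP fps_inv_out.

(* The monomial u ^ k. *)
Definition fpsXn (k : nat) : fps R := Fps (fun n => (n == k)%:R).

Lemma fps_unit1BXn k : (0 < k)%N -> 1 - fpsXn k \is a GRing.unit.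
Proof.
move=> k0; apply/unitrP; pose g : fps R := Fps (fun n => (k %| n)%:R).
suff gE : g * (1 - fpsXn k) = 1 by exists g; split=> [|]; rewrite ?gE // mulrC gE.
rewrite mulrC mulrBl mul1r; apply/eqP; rewrite subr_eq; apply/eqP.
apply: fpsP => n /=.
have [ltnk|lekn] := ltnP n k.
  rewrite big1 ?addr0 => [|i _]; last first.
    by rewrite ltn_eqF ?mul0r // (leq_trans (ltn_ord i)).
  case: n ltnk => [|n] ltnk; first by rewrite dvdn0.
  by rewrite gtnNdvd.
rewrite (bigD1 (Ordinal (lekn : (k < n.+1)%N))) //= eqxx mul1r.
rewrite big1 ?addr0 => [|i]; last by rewrite -val_eqE /= => /negPf ->; rewrite mul0r.
by rewrite gtn_eqF ?(leq_trans k0) // add0r -{1}(subnK lekn) dvdn_addl.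
Qed.

(* The product of F 1, F 2, F 3, ... in the u-adic topology: every coefficient
   of the partial products is eventually constant. *)
Definition cvg_infprod_to (F : nat -> fps R) (P : fps R) : Prop :=
  forall n, exists K0, forall K, (K0 <= K)%N ->
    coefs (\prod_(1 <= k < K.+1) F k) n = coefs P n.

Definition cvg_infprod F := exists P, cvg_infprod_to F P.

(* Meaningful only under [cvg_infprod F]; 0 otherwise. *)
Definition infprod F : fps R := xget 0 (cvg_infprod_to F).

Lemma cvg_infprod_unique F P Q :
  cvg_infprod_to F P -> cvg_infprod_to F Q -> P = Q.
Proof.
move=> FP FQ; apply: fpsP => n.
have [K1 h1] := FP n; have [K2 h2] := FQ n.
by rewrite -(h1 _ (leq_maxl K1 K2)) -(h2 _ (leq_maxr K1 K2)).
Qed.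

Lemma infprodE F P : cvg_infprod_to F P -> infprod F = P.
Proof. by move=> FP; apply: xget_unique => // Q /(cvg_infprod_unique FP). Qed.

End FpsRing.

Section PowerMap.
Variable F : finFieldType.

(* For n = 0 the library's 'GL_n[F] is 'GL_1[F], so this is to be used for
   n >= 1 only. *)
Definition num_power_classes (n M : nat) : nat :=
  #|[set C in (classes 'GL_n[F])%g |
      C \subset [set x ^+ M | x in 'GL_n[F]]%g]|.

Definition Phi (f : {poly F}) : Prop :=
  [/\ f \is monic, irreducible_poly f & f != 'X].

(* Degree d means size d.+1; such polynomials all live in {poly_d.+1 F}. *)
Definition N0 (M d : nat) : nat :=
  #|[set f : {poly_(d.+1) F} |
      `[< [/\ Phi f, size f = d.+1 &
           exists g : {poly F},
             [/\ irreducible_poly g, g %| f \Po 'X^M & size g = d.+1]] >]]|.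

Definition Npos (M r i d : nat) : nat :=
  #|[set f : {poly_(d.+1) F} |
      `[< [/\ Phi f, size f = d.+1 &
           forall g : {poly F},
             irreducible_poly g -> g %| f \Po 'X^M ->
             size g = (d * r ^ i).+1] >]]|.

(* The case i = 0 only asks for one factor of degree d, so it is not
   [Npos M r 0 d]. *)
Definition NM (M r i d : nat) : nat :=
  if i == 0%N then N0 M d else Npos M r i d.

(* 1 + sum_{n >= 1} c(n, q, M) u^n *)
Definition power_class_series (M : nat) : fps int :=
  Fps (fun n => if n == 0%N then 1 else (num_power_classes n M)%:Z).

End PowerMap.

(* Main.v *)
Require Import Defs.
From HB Require Import structures.
From mathcomp Require Import all_boot all_order all_fingroup all_algebra.
From mathcomp Require Import all_solvable all_field.
From mathcomp Require Import boolp classical_sets.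
From mathcomp Require Import zify ring.

(** By the theory of elementary divisors, a conjugacy class of GL(n, q) is a
    finite multiset of pairs (f, k), with f in Phi and k >= 1, such that the sum
    of the k deg f is n: the pair (f, k) stands for the summand F[X]/(f^k).  To
    recover the multiset from a matrix A, only the coranks of the f(A)^l are
    needed: l |-> corank f(A)^l is a sum of terms deg f * min(l, k), and second
    differences in l read off the multiplicities.  Existence of the
    decomposition is [exists_eldivs], and the resulting criterion of similarity
    is [similar_mx_corankP].

    Put M = r^a.  The matrix f(B^M) is the value at B of the polynomial f(X^M),
    which is squarefree since M is prime to q.  Hence the corank of f(B^M)^l is
    the sum of deg g * min(l, k) over the elementary divisors (g, k) of B such
    that g divides f(X^M).  So, in the passage from B to B^M, a pair (g, k)
    turns into deg g / deg f copies of (f, k), where f is the polynomial of Phi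
    with g | f(X^M).

    What can deg g / deg f be?  Let o be the multiplicative order of the roots
    of f.  If r does not divide o, then some g of the same degree as f exists.
    If r divides o, then the roots of every g have the same order M o, so all
    the g have the same degree, and this degree divides deg f * r^a
    ([Phi_factor_degree]).  Therefore every f in Phi has a well-defined
    exponent i <= a, its inertia, such that all the quotients deg g / deg f are
    multiples of r^i and some g attains r^i; the number of f of degree d with
    inertia i is N_M^i(q, d).  It follows that a multiset of pairs belongs to an
    M-th power exactly when every (f, k) has multiplicity divisible by r^i, i
    being the inertia of f ([eldivs_exp_count], [inflate_eldivs_exp]).

    Counting these multisets is counting families of multiplicities m(f, k)
    subject to sum m(f, k) k r^i deg f = n.  Their generating function is the
    product over (f, k) of 1 / (1 - u^(k r^i deg f)), and grouping the f by
    degree and inertia gives the product of the theorem, with j in the role of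
    k.  Convergence holds because the factor of index j, i, d is 1 modulo u^j
    and modulo u^d; for the same reason the coefficient of u^n only depends on
    the factors with j, d <= n. *)

Set Implicit Arguments.
Unset Strict Implicit.
Unset Printing Implicit Defensive.

Import GRing.Theory.
Local Open Scope ring_scope.

(** * Arithmetic *)

Lemma expn_gt1 b k : (1 < b)%N -> (0 < k)%N -> (1 < b ^ k)%N.
Proof. by move=> b1 k0; rewrite -(ltn_exp2l 0 k b1) expn0 in k0. Qed.

(** One step is the factorization
    Q^r - 1 = (Q - 1) (1 + Q + ... + Q^(r-1)): the last factor is a sum of r terms
    that are 1 modulo r. *)
Lemma dvdn_expn_sub1 r k o Q : (r %| o)%N -> (o %| Q.-1)%N -> (0 < Q)%N ->
  (r ^ k * o %| (Q ^ (r ^ k)).-1)%N.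
Proof.
move=> ro oQ Q0; elim: k => [|k IH]; first by rewrite !expn0 mul1n expn1.
rewrite expnSr expnM predn_exp mulnAC; apply: (dvdn_mul IH).
have Q1 : Q ^ (r ^ k) = 1 %[mod r].
  apply/eqP; rewrite eqn_mod_dvd ?expn_gt0 ?Q0 // subn1.
  by apply: dvdn_trans IH; rewrite dvdn_mull.
rewrite /dvdn -modn_summ (eq_bigr (fun=> (1 %% r)%N)) => [|i _]; last first.
  by rewrite -modnXm Q1 modnXm exp1n.
by rewrite modn_summ sum1_card card_ord modnn.
Qed.

(** The order og of an M-th root of an element of order o: if og
    contained less than the full power r^a, then o would divide the part of og
    prime to r, although r divides o. *)
Lemma order_mulr_prime_power r a o og : prime r -> (0 < og)%N -> (r %| o)%N ->
  (forall m, (o %| m) = (og %| r ^ a * m))%N -> og = (r ^ a * o)%N.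
Proof.
move=> r_pr og0 ro E; apply/eqP; rewrite eqn_dvd -E dvdnn /=.
have rog : (r ^ a %| og)%N.
  rewrite pfactor_dvdn // leqNgt; apply/negP => lta.
  have [s rs ogE] := pfactor_coprime r_pr og0.
  have : (o %| s)%N by rewrite E ogE mulnC dvdn_pmul2r ?dvdn_exp2l ?(ltnW lta) //;
      case: (s) ogE og0 => // ->.
  move/(dvdn_trans ro); apply/negP.
  by rewrite -prime_coprime.
have [m ogE] := dvdnP rog; rewrite ogE mulnC dvdn_pmul2r ?expn_gt0 ?prime_gt0 //.
by rewrite E ogE mulnC.
Qed.

(** The second difference of l |-> min(l, j) is concentrated at
    l = j. *)
Lemma minn_second_difference k j :
  ((j == k.+1) + minn k j + minn k.+2 j = 2 * minn k.+1 j)%N.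
Proof. by rewrite /minn; case: eqP => [->|jk]; do !case: ltnP => ? /=; lia. Qed.

Lemma sum_nseq (T : Type) m (x : T) (P : pred T) (W : T -> nat) :
  (\sum_(y <- nseq m x | P y) W y = if P x then m * W x else 0)%N.
Proof.
elim: m => [|m IH]; first by rewrite big_nil; case: ifP.
by rewrite big_cons IH; case: (P x); rewrite ?mulSn.
Qed.

(** * Irreducible polynomials *)

Section PolyFactor.
Variable K : fieldType.
Implicit Types f g h p q : {poly K}.

Lemma irreducible_dvdpM g p q :
  irreducible_poly g -> (g %| p * q) = (g %| p) || (g %| q).
Proof.
move=> gI; have [gp|ngp] := boolP (g %| p); first by rewrite dvdp_mulr.
by rewrite Gauss_dvdpr ?irreducible_poly_coprime.
Qed.

Lemma irreducible_size1 g : irreducible_poly g -> (g %| 1) = false.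
Proof. by case=> sg _; rewrite dvdp1; case: (size g) sg => [|[]]. Qed.

Lemma exists_irreducible_factor p : (1 < size p)%N ->
  exists f, [/\ f \is monic, irreducible_poly f & f %| p].
Proof.
have [m] := ubnP (size p); elim: m p => // m IH p lepm p1.
have [[h [h1 hp hd]]|noh] :=
    pselect (exists h, [/\ size h != 1%N, h %| p & ~~ (h %= p)]).
  have p0 : p != 0 by rewrite -size_poly_gt0 (ltn_trans _ p1).
  have h0 : h != 0 by apply: contraNneq p0 => h0; rewrite h0 dvd0p in hp.
  have lthp : (size h < size p)%N.
    by rewrite ltn_neqAle dvdp_leq // andbT dvdp_size_eqp.
  have [||f [fm fI fh]] := IH h; first exact: leq_trans lthp _.
    by move: h0 h1; rewrite -size_poly_gt0; case: (size h) => [|[]].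
  by exists f; split=> //; apply: dvdp_trans hp.
have p0 : p != 0 by rewrite -size_poly_gt0 (ltn_trans _ p1).
have lc0 : (lead_coef p)^-1 != 0 by rewrite invr_eq0 lead_coef_eq0.
exists ((lead_coef p)^-1 *: p); split; last by rewrite dvdpZl.
  by rewrite monicE lead_coefZ mulVf ?lead_coef_eq0.
split=> [|h h1]; first by rewrite size_scale.
rewrite dvdpZr // => hp.
rewrite (eqp_rtrans (eqp_scale p lc0)).
by apply: contra_notT noh => nh; exists h.
Qed.

Lemma monic_irreducible_eq f g : f \is monic -> g \is monic ->
  irreducible_poly f -> irreducible_poly g -> g %| f -> g = f.
Proof.
move=> fm gm [_ fI] [g1 _] gf; apply/eqP; rewrite -eqp_monic //; apply: fI => //.
by case: (size g) g1 => [|[]].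
Qed.

(** Induction on the factorization of p: an irreducible divisor of
    p(q) divides f(q) for one of the irreducible factors f of p. *)
Lemma irreducible_factor_comp g p q : irreducible_poly g -> p != 0 ->
  g %| p \Po q -> exists f, [/\ f \is monic, irreducible_poly f, f %| p & g %| f \Po q].
Proof.
move=> gI; have [m] := ubnP (size p); elim: m p => // m IH p lepm p0 gp.
have [p1|p1] := leqP (size p) 1.
  have /size_poly1P[c c0 pE] : size p == 1%N.
    by move: p0; rewrite -size_poly_gt0; case: (size p) p1 => [|[]].
  case/negP: (irreducible_size1 gI).
  by rewrite pE comp_polyC -alg_polyC dvdpZr // in gp.
have [f [fm fI fp]] := exists_irreducible_factor p1.
have [h pE] := dvdpP _ _ fp.
rewrite pE comp_polyM irreducible_dvdpM // in gp.
case/orP: gp => gp; last by exists f.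
have h0 : h != 0 by apply: contraNneq p0 => h0; rewrite pE h0 mul0r.
have lthm : (size h < m)%N.
  case: fI => f1 _; move: lepm; rewrite pE size_mul ?(monic_neq0 fm) //.
  case: (size f) f1 => [|[|n]] // _; rewrite !addnS /= ltnS.
  by apply: leq_ltn_trans; rewrite leq_addr.
have [f' [f'm f'I f'h gf']] := IH h lthm h0 gp.
by exists f'; rewrite pE dvdp_mulr.
Qed.

End PolyFactor.

(** * Orders and degrees of irreducible polynomials over a finite field *)

Section FiniteField.
Variable F : finFieldType.
Implicit Types f g h p q : {poly F}.

(** Raising to the power q, the cardinal of F, is additive on F[X] and
    fixes the constants. *)
Lemma poly_expr_card p m : p ^+ (#|F| ^ m) = p \Po 'X^(#|F| ^ m).
Proof.
have [r r_pr rF] := finPcharP F.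
elim/poly_ind: p => [|p c IH].
  by rewrite comp_poly0 expr0n expn_eq0; case: #|F| (finNzRing_gt1 F).
rewrite comp_poly_MXaddC -IH exprDn_pchar; last first.
  rewrite pnatX (card_pprimeChar rF) pnatX pnatE //.
  by rewrite (pchar_poly F) rF.
rewrite exprMn; congr (_ + _); rewrite -rmorphXn /=; congr (_%:P).
by elim: m {IH} => [|m IH]; rewrite ?expr1 // expnSr exprM IH expf_card.
Qed.

Lemma dvdp_sub_comp (p u v : {poly F}) : u - v %| (p \Po u) - (p \Po v).
Proof.
elim/poly_ind: p => [|p c IH]; first by rewrite !comp_poly0 subrr dvdp0.
rewrite !comp_poly_MXaddC opprD addrACA subrr addr0.
have ->: (p \Po u) * u - (p \Po v) * v =
  ((p \Po u) - (p \Po v)) * u + (p \Po v) * (u - v).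
  by rewrite mulrBl mulrBr addrA subrK.
by apply: dvdp_add; [apply: dvdp_mulr|apply: dvdp_mull].
Qed.

(** In the field K = F[X]/(g), of cardinal q^e with q = |F| and e = deg g, the condition
    says that the class of X, hence every element of K, is fixed by the m-th iterate
    of Frobenius.  The e-th iterate is the identity, so one may reduce m modulo e; and
    a nontrivial iterate of order m < e fixes at most q^m elements. *)
Lemma dvdp_Xcard g m : g \is monic -> irreducible_poly g ->
  (g %| 'X^(#|F| ^ m) - 'X) = ((size g).-1 %| m)%N.
Proof.
move=> gm girr; have gI : monic_irreducible_poly g by split.
have g1 : (1 < size g)%N by case: girr.
pose K : finFieldType := {poly %/ g with gI}.
pose pi : {poly F} -> K := in_qpoly g.
have piB p q : pi (p - q) = pi p - pi q by exact: (raddfB (in_qpoly g)).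
have piX p n : pi (p ^+ n) = pi p ^+ n by exact: (rmorphXn (in_qpoly g)).
have pi0 p : (pi p == 0) = (g %| p).
  by rewrite -val_eqE /= /mk_monic g1 gm /= Pdiv.Idomain.dvdpE.
have piK (y : K) : pi (val y) = y.
  by apply: val_inj; apply: in_qpoly_small; apply: size_mk_monic.
have cardK : #|K| = (#|F| ^ (size g).-1)%N by exact: card_qfpoly.
set e := (size g).-1 in cardK *.
have e0 : (0 < e)%N by rewrite /e; case: (size g) g1 => [|[]].
have frobK (y : K) k : y ^+ (#|F| ^ (k * e)) = y.
  elim: k => [|k IH]; first by rewrite mul0n expr1.
  by rewrite mulSn expnD mulnC exprM IH -cardK expf_card.
have -> : (g %| 'X^(#|F| ^ m) - 'X) = (pi 'X ^+ (#|F| ^ m) == pi 'X).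
  by rewrite -pi0 -[RHS]subr_eq0 -piX piB.
apply/eqP/idP => [fixX|/dvdnP[k ->]]; last exact: frobK.
have fixm (y : K) : y ^+ (#|F| ^ m) = y.
  rewrite -(piK y) -piX poly_expr_card; apply/eqP; rewrite -subr_eq0 -piB pi0.
  rewrite -{2}[val y]comp_polyXr; apply: dvdp_trans (dvdp_sub_comp _ _ _).
  by rewrite -pi0 piB piX fixX subrr.
have fixmod (y : K) : y ^+ (#|F| ^ (m %% e)) = y.
  by rewrite -[RHS]fixm {2}(divn_eq m e) expnD exprM frobK.
(* Otherwise X^(q^(m mod e)) - X would have q^e roots in K. *)
rewrite /dvdn; apply: contraT; rewrite -lt0n => me0.
pose P : {poly K} := 'X^(#|F| ^ (m %% e)) - 'X.
have q1 := finNzRing_gt1 F.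
have sP : size P = (#|F| ^ (m %% e)).+1.
  by rewrite size_polyDl size_polyXn // size_polyN size_polyX ltnS expn_gt1.
have P0 : P != 0 by rewrite -size_poly_gt0 sP.
have := @max_poly_roots _ P (enum K) P0 _ (enum_uniq _).
rewrite -cardE cardK sP ltnS leq_exp2l // leqNgt ltn_mod e0 /= => -> //.
by apply/allP => y _; rewrite rootE !hornerE fixmod subrr.
Qed.

Lemma irreducible_polyX : irreducible_poly ('X : {poly F}).
Proof. by rewrite -['X]subr0; apply: irredp_XsubC. Qed.

Lemma Phi_coprimeX f : Phi f -> coprimep f 'X.
Proof.
case=> fm fI fX; rewrite irreducible_poly_coprime //; apply: contra fX => fX.
by rewrite (monic_irreducible_eq _ _ _ _ fX) ?monicX //; apply: irreducible_polyX.
Qed.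

Lemma Phi_size f : Phi f -> (1 < size f)%N. Proof. by case=> _ []. Qed.

(** Since g is prime to X, this says that deg g is the order of q modulo
    the order of the roots of g; it turns all degree computations into divisibilities
    between integers. *)
Lemma Phi_dvdp_Xn_sub1 g m : Phi g ->
  (g %| 'X^((#|F| ^ m).-1) - 1) = ((size g).-1 %| m)%N.
Proof.
move=> gP; have [gm gI _] := gP; rewrite -dvdp_Xcard //.
have Q0 : (0 < #|F| ^ m)%N by rewrite expn_gt0 (ltnW (finNzRing_gt1 F)).
rewrite -[in RHS](prednK Q0).
by rewrite exprS -[X in _ = (_ %| _ - X)]mulr1 -mulrBr Gauss_dvdpr // Phi_coprimeX.
Qed.

Lemma dvdp_Xn_sub1 m n : (m %| n)%N -> ('X^m - 1 : {poly F}) %| 'X^n - 1.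
Proof.
case/dvdnP=> k ->; rewrite mulnC exprM.
have:= dvdp_sub_comp 'X^k 'X^m 1; rewrite !comp_Xn_poly expr1n; exact.
Qed.

(** The multiplicative order of the roots of f, expressed without leaving F[X]. *)
Lemma Phi_order f : Phi f ->
  exists2 o, (0 < o)%N & forall m, (f %| 'X^m - 1) = (o %| m)%N.
Proof.
move=> fP; have q1 := finNzRing_gt1 F.
have /ex_minnP[o /andP[o0 fo] omin] : exists o, (0 < o)%N && (f %| 'X^o - 1).
  exists (#|F| ^ (size f).-1).-1; rewrite Phi_dvdp_Xn_sub1 // dvdnn andbT.
  have := Phi_size fP; case: (size f) => [|[|n]] // _.
  by rewrite -ltnS prednK ?expn_gt0 ?(ltnW q1) // expn_gt1.
exists o => // m; apply/idP/idP => [fm|/dvdp_Xn_sub1]; last exact: dvdp_trans.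
rewrite /dvdn; apply: contraT; rewrite -lt0n => mo0.
have := omin (m %% o)%N; rewrite mo0 /= leqNgt ltn_mod o0 /= => -> //.
have fd : f %| 'X^(m %/ o * o) - 1 by apply: dvdp_trans fo (dvdp_Xn_sub1 _); rewrite dvdn_mull.
rewrite -(@Gauss_dvdpr _ _ 'X^(m %/ o * o)); last exact/coprimep_expr/Phi_coprimeX.
have -> : 'X^(m %/ o * o) * ('X^(m %% o) - 1) =
   ('X^m - 1) - ('X^(m %/ o * o) - 1) :> {poly F}.
  by rewrite mulrBr mulr1 -exprD -divn_eq opprB addrA subrK.
by rewrite dvdp_sub.
Qed.

(** If z is a root of f then z^c is a root of g, and (z^c)^m = 1 means
    z^(c m) = 1.  One direction is substitution of X^c; for the other one, if g
    were prime to X^m - 1 then g(X^c) would be prime to X^(c m) - 1, yet f divides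
    both. *)
Lemma dvdp_comp_order f g c m : irreducible_poly f -> irreducible_poly g ->
  f %| g \Po 'X^c -> (g %| 'X^m - 1) = (f %| 'X^(c * m) - 1).
Proof.
move=> fI gI fg.
have E : ('X^m - 1) \Po 'X^c = 'X^(c * m) - 1 :> {poly F}.
  by rewrite comp_polyB comp_Xn_poly -exprM rmorph1.
apply/idP/idP => [/(dvdp_comp_poly 'X^c)|fd]; first by rewrite E; apply: dvdp_trans.
apply: contraT; rewrite -irreducible_poly_coprime // => /(coprimep_comp_poly 'X^c).
rewrite E => /(coprimep_dvdl fd) /coprimepP /(_ f fg (dvdpp f)).
by rewrite -size_poly_eq1 -dvdp1 irreducible_size1.
Qed.

Lemma Phi_deg_eq f g : Phi f -> Phi g ->
  (forall m, (f %| 'X^m - 1) = (g %| 'X^m - 1)) -> size f = size g.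
Proof.
move=> fP gP E; have [sf sg] := (Phi_size fP, Phi_size gP).
suff: (size f).-1 = (size g).-1 by case: (size f) (size g) sf sg => [|m] [|n] //= _ _ ->.
apply/eqP; rewrite eqn_dvd -!Phi_dvdp_Xn_sub1 // -E E.
by rewrite !Phi_dvdp_Xn_sub1 ?dvdnn.
Qed.

Lemma Phi_factor_comp f g M : (0 < M)%N -> Phi f ->
  g \is monic -> irreducible_poly g -> g %| f \Po 'X^M -> Phi g.
Proof.
move=> M0 fP gm gI gf; split=> //; apply/negP => /eqP gX.
have := coprimep_comp_poly 'X^M (Phi_coprimeX fP).
rewrite comp_polyX => /coprimepP/(_ g gf).
rewrite gX (@dvdp_exp2l _ _ 1 M) // => /(_ isT).
by rewrite -size_poly_eq1 size_polyX.
Qed.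

Lemma natr_coprime_card M : coprime #|F| M -> M%:R != 0 :> F.
Proof.
have [r r_pr rF] := finPcharP F => cM; rewrite -(dvdn_pcharf rF).
rewrite -prime_coprime //; apply: coprime_dvdl cM.
rewrite (card_pprimeChar rF) -{1}(expn1 r) dvdn_exp2l //.
have := finNzRing_gt1 F; rewrite {1}(card_pprimeChar rF).
by case: logn.
Qed.

(** f divides some X^N - 1 with N + 1 a power of q, so f(X^M) divides
    X^(M N) - 1, whose exponent is invertible in F. *)
Lemma Phi_comp_separable f M : Phi f -> coprime #|F| M ->
  separable_poly (f \Po 'X^M).
Proof.
move=> fP cM; set N := (#|F| ^ (size f).-1).-1.
have : f %| 'X^N - 1 by rewrite Phi_dvdp_Xn_sub1.
move/(dvdp_comp_poly 'X^M) => d; apply: dvdp_separable d _.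
rewrite comp_polyB comp_Xn_poly -exprM rmorph1; apply: separable_Xn_sub_1.
rewrite natrM mulf_neq0 ?natr_coprime_card //.
rewrite /N; have := Phi_size fP; case: (size f) => [|[|n]] //= _.
by rewrite coprime_sym -(@coprime_pexpr n.+1) // coprimePn ?expn_gt0 ?(ltnW (finNzRing_gt1 F)).
Qed.

(** * Degrees of the irreducible factors of f(X^M) *)

Section PowerFactors.
Variables (r a : nat).
Hypothesis r_prime : prime r.
Local Notation M := (r ^ a)%N.

Let M_gt0 : (0 < M)%N. Proof. by rewrite expn_gt0 prime_gt0. Qed.

Lemma exists_Phi_factor_comp f : Phi f -> exists2 g, Phi g & g %| f \Po 'X^M.
Proof.
move=> fP; have [|g [gm gI gf]] := @exists_irreducible_factor _ (f \Po 'X^M).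
  have := size_comp_poly f 'X^M; rewrite size_polyXn /= => E.
  suff: (0 < (size (f \Po 'X^M)).-1)%N by case: size => [|[]].
  by rewrite E muln_gt0 M_gt0 andbT; have := Phi_size fP; case: size => [|[]].
by exists g => //; apply: Phi_factor_comp gf.
Qed.

(** When r does not divide the order o of a root z of f, the M-th
    power map is bijective on the powers of z: with c M = 1 modulo o, the element z^c
    is an M-th root of z that generates the same field.  Its minimal polynomial is
    found as a factor g of f(X^M) with f | g(X^c). *)
Lemma Phi_factor_same_degree f o : Phi f -> ~~ (r %| o)%N -> (0 < o)%N ->
    (forall m, (f %| 'X^m - 1) = (o %| m)%N) ->
  exists g, [/\ Phi g, g %| f \Po 'X^M & size g = size f].
Proof.
move=> fP nro o0 ford; have [fm fI _] := fP.
have copM : coprime M o by rewrite coprimeXl // prime_coprime.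
set c := (M ^ (totient o).-1)%N.
have cM : c * M = 1 %[mod o].
  by rewrite -expnSr prednK ?totient_gt0 // Euler_exp_totient.
(* This polynomial is f(X^(c M)), and f divides X^(c M) - X. *)
have fc : f %| (f \Po 'X^M) \Po 'X^c.
  rewrite -comp_polyA comp_Xn_poly -exprM.
  have fX : f %| 'X^(c * M) - 'X.
    have cM0 : (0 < c * M)%N by rewrite muln_gt0 M_gt0 expn_gt0 M_gt0.
    rewrite -(prednK cM0) exprS -[X in _ - X]mulr1 -mulrBr dvdp_mull //.
    by rewrite ford -subn1 -eqn_mod_dvd // eq_sym cM.
  have := dvdp_trans fX (dvdp_sub_comp f _ _).
  by rewrite comp_polyXr dvdp_subl.
have fM0 : f \Po 'X^M != 0 by rewrite comp_poly_eq0 ?monic_neq0 // size_polyXn.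
have [g [gm gI gf fg]] := irreducible_factor_comp fI fM0 fc.
have gP : Phi g by apply: Phi_factor_comp gf.
exists g; split=> //; apply: Phi_deg_eq => // m.
rewrite (dvdp_comp_order _ fI gI fg) !ford Gauss_dvdr //.
by rewrite coprime_sym coprimeXl.
Qed.

(** When r divides the order o of the roots of f, the M-th roots of these
    have order M o, hence a common degree over F; this degree is a multiple of deg f and
    divides deg f * M because o | q^(deg f) - 1 gives M o | q^(deg f * M) - 1. *)
Lemma Phi_factor_degree f : Phi f ->
  (exists g, [/\ Phi g, g %| f \Po 'X^M & size g = size f]) \/
  (exists2 i, (0 < i <= a)%N & forall g, Phi g -> g %| f \Po 'X^M ->
     (size g).-1 = ((size f).-1 * r ^ i)%N).
Proof.
move=> fP; have [fm fI _] := fP; have [o o0 ford] := Phi_order fP.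
have [ro|nro] := boolP (r %| o)%N; last first.
  by left; apply: Phi_factor_same_degree ford.
have q0 : (0 < #|F|)%N by rewrite ltnW ?finNzRing_gt1.
have degE g m : Phi g -> g %| f \Po 'X^M ->
    ((size g).-1 %| m)%N = (M * o %| (#|F| ^ m).-1)%N.
  move=> gP gf; have [gm gI _] := gP; have [og og0 gord] := Phi_order gP.
  rewrite -Phi_dvdp_Xn_sub1 // gord; congr (_ %| _)%N.
  apply: order_mulr_prime_power => // k.
  by rewrite -ford -gord (dvdp_comp_order _ gI fI gf).
have [g0 g0P g0f] := exists_Phi_factor_comp fP.
have fg : ((size f).-1 %| (size g0).-1)%N.
  rewrite -Phi_dvdp_Xn_sub1 // ford.
  apply: (@dvdn_trans (M * o)); first by rewrite dvdn_mull.
  by rewrite -(degE g0).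
have sf0 : (0 < (size f).-1)%N by case: (size f) (Phi_size fP) => [|[]].
have : ((size g0).-1 %| (size f).-1 * M)%N.
  rewrite degE // expnM; apply: dvdn_expn_sub1; rewrite ?expn_gt0 ?q0 //.
  by rewrite -ford Phi_dvdp_Xn_sub1.
have [k g0E] := dvdnP fg; rewrite g0E mulnC dvdn_pmul2l //.
case/(dvdn_pfactor _ _ r_prime) => i lei kE.
have eqdeg g : Phi g -> g %| f \Po 'X^M -> (size g).-1 = (size g0).-1.
  move=> gP gf; apply/eqP.
  by rewrite eqn_dvd degE // -(degE g0) // dvdnn (degE g0) // -(degE g) // dvdnn.
have [i0|i0] := posnP i; [left|right].
  exists g0; split=> //; move: g0E; rewrite kE i0 mul1n.
  by case: (size g0) (Phi_size g0P) => [|n] // _ /= ->; rewrite prednK // ltnW // Phi_size.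
by exists i => [|g gP gf]; rewrite ?i0 // eqdeg // g0E kE mulnC.
Qed.

End PowerFactors.
End FiniteField.

(** * Similarity and coranks of polynomials in a matrix *)

Section Matrices.
Variable K : fieldType.
Implicit Types p q f g h : {poly K}.

(** The value p(A), for matrices of any size: the ring structure needed by
    [horner_mx] excludes size 0, where all matrices are equal. *)
Definition mxhorner n : 'M[K]_n -> {poly K} -> 'M[K]_n :=
  if n is n'.+1 return 'M[K]_n -> {poly K} -> 'M[K]_n
  then fun A p => horner_mx A p else fun A _ => A.
Arguments mxhorner : simpl never.

Lemma mxhorner_is_zmod_morphism n (A : 'M[K]_n) : zmod_morphism (mxhorner A).
Proof.
case: n A => [|n] A p q; last exact: (rmorphB (horner_mx A)).
by apply/matrixP => -[].
Qed.

Lemma mxhorner_is_monoid_morphism n (A : 'M[K]_n) : monoid_morphism (mxhorner A).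
Proof.
case: n A => [|n] A; last first.
  by split=> [|p q]; [exact: (rmorph1 (horner_mx A))|exact: (rmorphM (horner_mx A))].
by split=> [|p q]; apply/matrixP => -[].
Qed.

HB.instance Definition _ n (A : 'M[K]_n) :=
  GRing.isZmodMorphism.Build {poly K} 'M[K]_n (mxhorner A)
    (mxhorner_is_zmod_morphism A).
HB.instance Definition _ n (A : 'M[K]_n) :=
  GRing.isMonoidMorphism.Build {poly K} 'M[K]_n (mxhorner A)
    (mxhorner_is_monoid_morphism A).

Lemma mxhornerM n (A : 'M[K]_n) p q :
  mxhorner A (p * q) = mxhorner A p *m mxhorner A q.
Proof. by rewrite rmorphM. Qed.

Lemma mxhornerX n (A : 'M[K]_n) : mxhorner A 'X = A.
Proof. by case: n A => [|n] A //; apply: horner_mx_X. Qed.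

Lemma mxhornerC n (A : 'M[K]_n) c : mxhorner A c%:P = c%:M.
Proof.
case: n A => [|n] A; last exact: horner_mx_C.
by apply/matrixP => -[].
Qed.

Lemma mxhorner_intertwine m n (A : 'M[K]_m) (B : 'M[K]_n) (P : 'M[K]_(m, n)) p :
  A *m P = P *m B -> mxhorner A p *m P = P *m mxhorner B p.
Proof.
move=> AP; elim/poly_ind: p => [|p c IH]; first by rewrite !rmorph0 mul0mx mulmx0.
rewrite !rmorphD /= !mxhornerM !mxhornerX !mxhornerC mulmxDl mulmxDr.
by rewrite -mulmxA AP mulmxA IH -mulmxA mul_scalar_mx mul_mx_scalar.
Qed.

Lemma mxhorner_block m n (A : 'M[K]_m) (B : 'M[K]_n) p :
  mxhorner (block_mx A 0 0 B) p = block_mx (mxhorner A p) 0 0 (mxhorner B p).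
Proof.
elim/poly_ind: p => [|p c IH]; first by rewrite !rmorph0 block_mx0.
rewrite !rmorphD /= !mxhornerM !mxhornerX !mxhornerC IH mulmx_block.
by rewrite scalar_mx_block add_block_mx !(mulmx0, mul0mx, addr0, add0r).
Qed.

Lemma mxhorner_exp n (A : 'M[K]_n) k p :
  mxhorner (A ^+ k) p = mxhorner A (p \Po 'X^k).
Proof.
elim/poly_ind: p => [|p c IH]; first by rewrite comp_poly0 !rmorph0.
rewrite comp_poly_MXaddC !rmorphD !rmorphM /= IH !mxhornerX !mxhornerC.
by rewrite rmorphXn /= mxhornerX.
Qed.

(** The formats are not required to be convertible, which spares casts between
    matrices whose sizes are equal only by a proof. *)
Definition similar_mx m n (A : 'M[K]_m) (B : 'M[K]_n) : Prop :=
  exists (P : 'M[K]_(m, n)) (Q : 'M[K]_(n, m)),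
    [/\ P *m Q = 1%:M, Q *m P = 1%:M & A *m P = P *m B].

Lemma similar_mx_refl n (A : 'M[K]_n) : similar_mx A A.
Proof. by exists 1%:M, 1%:M; rewrite !mulmx1 mul1mx. Qed.

Lemma similar_mx_sym m n (A : 'M[K]_m) (B : 'M[K]_n) :
  similar_mx A B -> similar_mx B A.
Proof.
case=> P [Q [PQ QP AP]]; exists Q, P; split=> //.
by rewrite -[Q *m A]mulmx1 -PQ -mulmxA (mulmxA A) AP !mulmxA QP mul1mx.
Qed.

Lemma similar_mx_trans m n l (A : 'M[K]_m) (B : 'M[K]_n) (C : 'M[K]_l) :
  similar_mx A B -> similar_mx B C -> similar_mx A C.
Proof.
case=> P [Q [PQ QP AP]] [P' [Q' [PQ' QP' AP']]]; exists (P *m P'), (Q' *m Q).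
split; last by rewrite mulmxA AP -mulmxA AP' mulmxA.
  by rewrite mulmxA -(mulmxA P) PQ' mulmx1.
by rewrite mulmxA -(mulmxA Q') QP mulmx1.
Qed.

Lemma similar_mx_dim m n (A : 'M[K]_m) (B : 'M[K]_n) : similar_mx A B -> m = n.
Proof.
case=> P [Q [PQ QP _]]; apply/eqP; rewrite eqn_leq.
by rewrite (mulmx1_min PQ) (mulmx1_min QP).
Qed.

Lemma similar_mx_block m n m' n' (A : 'M[K]_m) (B : 'M[K]_n)
    (A' : 'M[K]_m') (B' : 'M[K]_n') :
  similar_mx A B -> similar_mx A' B' ->
  similar_mx (block_mx A 0 0 A') (block_mx B 0 0 B').
Proof.
case=> P [Q [PQ QP AP]] [P' [Q' [PQ' QP' AP']]].
exists (block_mx P 0 0 P'), (block_mx Q 0 0 Q').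
by split; rewrite !mulmx_block !(mulmx0, mul0mx, addr0, add0r) ?PQ ?PQ' ?QP ?QP'
  -?scalar_mx_block ?AP ?AP'.
Qed.

Lemma similar_mx_swap m n l (A : 'M[K]_m) (B : 'M[K]_n) (C : 'M[K]_l) :
  similar_mx (block_mx A 0 0 (block_mx B 0 0 C))
             (block_mx B 0 0 (block_mx A 0 0 C)).
Proof.
exists (block_mx 0 (row_mx 1%:M 0) (col_mx 1%:M 0) (block_mx 0 0 0 1%:M)).
exists (block_mx 0 (row_mx 1%:M 0) (col_mx 1%:M 0) (block_mx 0 0 0 1%:M)).
have E : col_mx (row_mx 1%:M 0) 0 + block_mx 0 0 0 1%:M = 1%:M :> 'M[K]_(m + l).
  rewrite -[X in col_mx _ X]row_mx0 -/(block_mx _ _ _ _) add_block_mx !addr0 add0r.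
  by rewrite -scalar_mx_block.
have E' : col_mx (row_mx 1%:M 0) 0 + block_mx 0 0 0 1%:M = 1%:M :> 'M[K]_(n + l).
  rewrite -[X in col_mx _ X]row_mx0 -/(block_mx _ _ _ _) add_block_mx !addr0 add0r.
  by rewrite -scalar_mx_block.
by split; rewrite !(mulmx_block, mul_row_col, mul_row_block, mul_block_col,
  mul_col_mx, mul_mx_row, mulmx0, mul0mx, addr0, add0r, mul1mx, mulmx1,
  mul_col_row, row_mx0, col_mx0, E, E') -?scalar_mx_block.
Qed.

Lemma similar_mx_exp m n (A : 'M[K]_m) (B : 'M[K]_n) k :
  similar_mx A B -> similar_mx (A ^+ k) (B ^+ k).
Proof.
case=> P [Q [PQ QP AP]]; exists P, Q; split=> //.
have := mxhorner_intertwine 'X^k AP.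
by rewrite !rmorphXn /= !mxhornerX.
Qed.

(** The dimension of the kernel of p(A). *)
Definition corank n (A : 'M[K]_n) p := (n - \rank (mxhorner A p))%N.

Lemma similar_mx_corank m n (A : 'M[K]_m) (B : 'M[K]_n) p :
  similar_mx A B -> corank A p = corank B p.
Proof.
move=> AB; have mn := similar_mx_dim AB; subst n.
case: AB => P [Q [PQ QP AP]]; rewrite /corank; congr (_ - _)%N.
have [uP _] := mulmx1_unit PQ.
have [uQ _] := mulmx1_unit QP.
rewrite -(@mxrankMfree _ _ _ _ _ P) ?row_free_unit // (mxhorner_intertwine _ AP).
by rewrite eqmxMfull // row_full_unit.
Qed.

Lemma corank_block m n (A : 'M[K]_m) (B : 'M[K]_n) p :
  corank (block_mx A 0 0 B) p = (corank A p + corank B p)%N.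
Proof.
rewrite /corank mxhorner_block rank_diag_block_mx.
have := rank_leq_row (mxhorner A p); have := rank_leq_row (mxhorner B p); lia.
Qed.

Lemma corank_exp n (A : 'M[K]_n) k p : corank (A ^+ k) p = corank A (p \Po 'X^k).
Proof. by rewrite /corank mxhorner_exp. Qed.

(** * Companion matrices *)

Lemma eq_mulmx_rV m n (A B : 'M[K]_(m, n)) :
  (forall u : 'rV_m, u *m A = u *m B) -> A = B.
Proof. by move=> AB; apply/row_matrixP => i; rewrite !rowE. Qed.

Lemma rVpoly_eq0 d (u : 'rV[K]_d) : (rVpoly u == 0) = (u == 0).
Proof.
apply/eqP/eqP => [u0|->]; last exact: raddf0.
by rewrite -[u]rVpolyK u0 raddf0.
Qed.

Lemma size_rVpoly_lt g (u : 'rV[K]_(size g).-1) :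
  g != 0 -> (size (rVpoly u) < size g)%N.
Proof.
by move=> g0; rewrite (leq_ltn_trans (size_poly _ _)) // ltn_predL size_poly_gt0.
Qed.

(** A row vector u is the class of the polynomial rVpoly u in
    F[X]/(g), and the companion matrix acts as multiplication by X. *)
Lemma companion_mulX g (u : 'rV[K]_(size g).-1) : g \is monic ->
  g %| rVpoly (u *m companionmx g) - rVpoly u * 'X.
Proof.
move=> gm; rewrite mulmx_sum_row {2}[u]row_sum_delta !linear_sum mulr_suml -sumrB.
apply: (big_ind (fun p => g %| p)) => [|p q|i _]; first exact: dvdp0.
  exact: dvdp_add.
rewrite !linearZ /= -scalerAl -scalerBr -mul_polyC dvdp_mull //.
rewrite rVpoly_delta -exprSr; set D := (size g).-1 in i *.
have gs : (0 < size g)%N by rewrite size_poly_gt0 monic_neq0.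
suff -> : rVpoly (row i (companionmx g)) - 'X^(i.+1) = if i.+1 == D then - g else 0.
  by case: ifP => _; rewrite ?dvdp0 // dvdpNr.
apply/polyP => j; rewrite coefB coefXn; have [ltjD|lejD] := ltnP j D.
  rewrite (coef_rVpoly_ord _ (Ordinal ltjD)) !mxE /=.
  have [iD|iD] := eqVneq i.+1 D.
    have -> : (i == (size g).-2 :> nat) by apply/eqP; exact: (congr1 predn iD).
    by rewrite coefN ltn_eqF ?subr0 // iD.
  have /negPf -> : i != (size g).-2 :> nat.
    by apply: contra iD => /eqP ->; rewrite -/D prednK // (leq_ltn_trans _ (ltn_ord i)).
  by rewrite coef0 [j == _]eq_sym subrr.
rewrite nth_default ?(leq_trans (size_poly _ _)) // sub0r.
have [iD|iD] := eqVneq i.+1 D; last first.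
  have ltiD : (i.+1 < D)%N by rewrite ltn_neqAle iD ltn_ord.
  by rewrite coef0 gtn_eqF ?oppr0 // (leq_trans ltiD).
rewrite iD coefN; have [->|jD] := eqVneq j D.
  by rewrite -/(lead_coef g) (eqP gm).
rewrite nth_default // -(prednK gs) -/D ltn_neqAle eq_sym jD.
by [].
Qed.

Lemma companion_mxhorner g (u : 'rV[K]_(size g).-1) p : g \is monic ->
  g %| rVpoly (u *m mxhorner (companionmx g) p) - rVpoly u * p.
Proof.
move=> gm; elim/poly_ind: p => [|p c IH]; first by rewrite raddf0 mulmx0 raddf0 mulr0 subr0 dvdp0.
rewrite raddfD /= mxhornerM mxhornerX mxhornerC mulmxDr mulmxA mul_mx_scalar.
rewrite raddfD /= linearZ /= mulrDr opprD addrACA [rVpoly u * c%:P]mulrC mul_polyC subrr addr0.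
have := dvdp_add (companion_mulX (u *m mxhorner (companionmx g) p) gm) (dvdp_mulr 'X IH).
by rewrite mulrBl addrA subrK mulrA.
Qed.

Lemma companion_mxhorner_small g (u : 'rV[K]_(size g).-1) p : g \is monic ->
  (size (rVpoly u * p)%R < size g)%N ->
  rVpoly (u *m mxhorner (companionmx g) p) = rVpoly u * p.
Proof.
move=> gm sup; apply/eqP; rewrite -subr_eq0; apply: contraT => nz.
have := dvdp_leq nz (companion_mxhorner u p gm); rewrite leqNgt.
case/negP; apply: leq_ltn_trans (size_polyD _ _) _; rewrite size_polyN gtn_max sup andbT.
exact/size_rVpoly_lt/monic_neq0.
Qed.

Lemma companion_root g : g \is monic -> mxhorner (companionmx g) g = 0.
Proof.
move=> gm; apply: eq_mulmx_rV => u; rewrite mulmx0; apply/eqP.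
rewrite -rVpoly_eq0; apply: contraT => nz.
have : g %| rVpoly (u *m mxhorner (companionmx g) g).
  by rewrite -(dvdp_subl _ (dvdp_mull (rVpoly u) (dvdpp g))) companion_mxhorner.
move/(dvdp_leq nz); rewrite leqNgt; case/negP.
exact/size_rVpoly_lt/monic_neq0.
Qed.

(** The classes X^i h for i < deg g - deg h need no reduction modulo g, so
    they are linearly independent. *)
Lemma companion_rank_ge g h : g \is monic -> h != 0 ->
  ((size g).-1 <= \rank (mxhorner (companionmx g) h) + (size h).-1)%N.
Proof.
move=> gm h0; rewrite addnC -leq_subLR; set d := (_ - _)%N.
have [d0|dpos] := posnP d; first by rewrite d0.
have gs : (0 < size g)%N by rewrite size_poly_gt0 monic_neq0.
have hs : (0 < size h)%N by rewrite size_poly_gt0.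
pose E : 'M[K]_(d, (size g).-1) := lin1_mx (@poly_rV K _ \o @rVpoly K d).
suff freeEh : row_free (E *m mxhorner (companionmx g) h).
  by rewrite -{1}(eqnP freeEh) mxrankM_maxr.
apply: inj_row_free => c; rewrite mulmxA mul_rV_lin1 /= => ch0.
have cE : rVpoly (poly_rV (rVpoly c) : 'rV_(size g).-1) = rVpoly c.
  by rewrite poly_rV_K // (leq_trans (size_poly _ _)) // leq_subr.
apply/eqP; rewrite -rVpoly_eq0.
have := congr1 (@rVpoly K _) ch0; rewrite raddf0 companion_mxhorner_small //.
  by rewrite cE => /eqP; rewrite mulf_eq0 (negPf h0) orbF.
rewrite cE; have [->|c0] := eqVneq (rVpoly c) 0; first by rewrite mul0r size_poly0.
rewrite size_mul // -(prednK gs) ltnS -(prednK hs) addnS /=.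
have sc : (size (rVpoly c) <= d)%N by apply: size_poly.
by rewrite addnC -leq_subRL // ltnW // -subn_gt0.
Qed.

(** The matrices p(C) and h(C), where h is the gcd of p and g, are
    multiples of each other, so they have the same rank.  For a divisor h of g with
    g = h' h, the lower bounds for the ranks of h(C) and h'(C) are attained, because
    h'(C) h(C) = 0. *)
Lemma corank_companion g p : g \is monic ->
  corank (companionmx g) p = (size (gcdp p g)).-1.
Proof.
move=> gm; have g0 := monic_neq0 gm; set h := gcdp p g; set C := companionmx g.
have h0 : h != 0 by rewrite gcdp_eq0 negb_and g0 orbT.
have [h' gE] := dvdpP _ _ (dvdp_gcdr p g : h %| g).
have h'0 : h' != 0 by apply: contraNneq g0 => h'0; rewrite gE h'0 mul0r.
have rankE : \rank (mxhorner C p) = \rank (mxhorner C h).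
  apply/eqP; rewrite eqn_leq; apply/andP; split.
    have [p' ->] := dvdpP _ _ (dvdp_gcdl p g : h %| p).
    by rewrite mxhornerM mxrankM_maxr.
  have [[u v] /= uv] := Bezoutp p g.
  have /eqpf_eq[c c0 ->] : h %= u * p + v * g by rewrite eqp_sym.
  rewrite -mul_polyC mxhornerM rmorphD /= !mxhornerM companion_root // mulmx0 addr0.
  exact: leq_trans (mxrankM_maxr _ _) (mxrankM_maxr _ _).
have := companion_rank_ge gm h0; have := companion_rank_ge gm h'0.
have : (\rank (mxhorner C h') + \rank (mxhorner C h) <= (size g).-1)%N.
  by rewrite -leq_subRL ?rank_leq_row // -mxrank_ker mxrankS //; apply/sub_kermxP;
     rewrite -mxhornerM mulrC -gE companion_root.
rewrite /corank rankE -/C.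
have : size g = (size h' + size h).-1 by rewrite {1}gE size_mul.
have : (0 < size h)%N by rewrite size_poly_gt0.
have : (0 < size h')%N by rewrite size_poly_gt0.
move: (\rank (mxhorner C h)) (\rank (mxhorner C h')) => x y.
move: (size g) (size h) (size h') => a b c; lia.
Qed.

(** * Splitting off a primary cyclic summand *)

Lemma mul_rV_powers n d (A : 'M[K]_n) (v : 'rV[K]_n) (c : 'rV[K]_d) :
  c *m (\matrix_(i < d) (v *m mxhorner A 'X^i)) = v *m mxhorner A (rVpoly c).
Proof.
rewrite mulmx_sum_row [in RHS](row_sum_delta c) linear_sum /= raddf_sum /= mulmx_sumr.
apply: eq_bigr => i _; rewrite rowK linearZ /= rVpoly_delta -mul_polyC mxhornerM.
by rewrite mxhornerC mul_scalar_mx scalemxAr.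
Qed.

Lemma mxhorner_tr n (A : 'M[K]_n) p : mxhorner A^T p = (mxhorner A p)^T.
Proof.
elim/poly_ind: p => [|p c IH]; first by rewrite !raddf0.
rewrite !raddfD /= [in LHS]mulrC !mxhornerM !mxhornerX !mxhornerC trmx_mul IH.
by rewrite tr_scalar_mx.
Qed.

Lemma mul_powers_cV n d (A : 'M[K]_n) (w : 'cV[K]_n) (c : 'rV[K]_d) :
  (\matrix_(i < d) (w^T *m mxhorner A^T 'X^i))^T *m c^T = mxhorner A (rVpoly c) *m w.
Proof. by rewrite -trmx_mul mul_rV_powers mxhorner_tr trmx_mul !trmxK. Qed.

Lemma dvdp_irreducible_exp f k d : irreducible_poly f ->
  d %| f ^+ k.+1 -> (d %| f ^+ k) || (f ^+ k.+1 %| d).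
Proof.
move=> fI; have f0 := irredp_neq0 fI.
elim: k d => [|k IH] d; have [fd|nfd] := boolP (f %| d).
- by rewrite orbT.
- by rewrite exprS Gauss_dvdpr ?[coprimep d f]coprimep_sym ?irreducible_poly_coprime // => ->.
- have [d' ->] := dvdpP _ _ fd.
  rewrite ![f ^+ _.+1]exprSr !dvdp_mul2r // -exprSr; exact: IH.
- by rewrite exprS Gauss_dvdpr ?[coprimep d f]coprimep_sym ?irreducible_poly_coprime // => ->.
Qed.

(** The nonzero ideals of F[X]/(f^(k+1)) all contain the class of
    f^k. *)
Lemma dvdp_irreducible_exp_bezout f k q : irreducible_poly f ->
  ~~ (f ^+ k.+1 %| q) -> exists p, f ^+ k.+1 %| q * p - f ^+ k.
Proof.
move=> fI nq; have := dvdp_irreducible_exp fI (dvdp_gcdr q (f ^+ k.+1)).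
rewrite dvdp_gcd dvdpp andbT (negPf nq) orbF => /dvdpP[w fkE].
have [[u1 u2] /= uv] := Bezoutp q (f ^+ k.+1).
have /eqpf_eq[c c0 gE] : gcdp q (f ^+ k.+1) %= u1 * q + u2 * f ^+ k.+1 by rewrite eqp_sym.
exists (w * (c%:P * u1)).
have -> : q * (w * (c%:P * u1)) - f ^+ k = (- w * c%:P * u2) * f ^+ k.+1.
  by rewrite [in X in _ - X]fkE gE -mul_polyC; ring.
exact: dvdp_mull.
Qed.

(** The rows of R span an invariant subspace, and the kernel of S is an
    invariant complement of it as soon as R S is invertible. *)
Lemma split_stable n d (A : 'M[K]_n) (C : 'M[K]_d) (R : 'M[K]_(d, n)) (S : 'M[K]_(n, d)) :
  R *m A = C *m R -> stablemx (kermx S) A -> row_free (R *m S) ->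
  exists m (B : 'M[K]_m), similar_mx A (block_mx C 0 0 B).
Proof.
move=> RA Sstab freeRS; pose U := row_base (kermx S).
have RU0 : (R :&: kermx S)%MS = 0.
  apply/eqP; rewrite -submx0; apply/rV_subP => x.
  rewrite sub_capmx sub_kermx => /andP[/submxP[c ->] /eqP].
  rewrite -mulmxA -[RHS](mul0mx _ (R *m S)) => /(row_free_inj freeRS) ->.
  by rewrite mul0mx sub0mx.
have freeR : row_free R.
  by rewrite /row_free eqn_leq rank_leq_row -{1}(eqnP freeRS) mxrankM_maxl.
have rankP : \rank (col_mx R U) = (d + \rank (kermx S))%N.
  by rewrite -addsmxE (adds_eqmx (eqmx_refl R) (eq_row_base _)) mxrank_disjoint_sum // (eqnP freeR).
pose P := col_mx R U.
have freeP : row_free P by rewrite /row_free rankP.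
have fullP : row_full P.
  by rewrite -col_leq_rank rankP mxrank_ker; have := rank_leq_col S; lia.
exists (\rank (kermx S)), (U *m A *m pinvmx U); apply: similar_mx_sym.
exists P, (pinvmx P); split; rewrite ?mulmxVp ?mulVpmx //.
rewrite mul_block_col !mul0mx addr0 add0r mul_col_mx RA mulmxKpV //.
rewrite /U (submx_trans _ (_ : kermx S <= _)%MS) ?eq_row_base //.
by rewrite (submx_trans _ Sstab) // submxMr // eq_row_base.
Qed.

Lemma exists_prime_power_factor p : (1 < size p)%N ->
  exists f k h, [/\ f \is monic, irreducible_poly f, ~~ (f %| h) & p = h * f ^+ k.+1].
Proof.
move=> p1; have [f [fm fI fp]] := exists_irreducible_factor p1.
have p0 : p != 0 by rewrite -size_poly_gt0 (ltn_trans _ p1).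
have f1 : (1 < size f)%N by case: fI.
have [k [h [nfh pE]]] : exists k h, ~~ (f %| h) /\ p = h * f ^+ k.
  have [m] := ubnP (size p); elim: m p {p1 fp} p0 => // m IH p p0 lepm.
  have [fp|nfp] := boolP (f %| p); last by exists 0%N, p; rewrite expr0 mulr1.
  have [h pE] := dvdpP _ _ fp.
  have h0 : h != 0 by apply: contraNneq p0 => h0; rewrite pE h0 mul0r.
  have [|k [h' [nfh' hE]]] := IH h h0.
    move: lepm; rewrite pE size_mul ?(monic_neq0 fm) //.
    case: (size f) f1 => [|[|n]] // _; rewrite !addnS /= ltnS.
    by apply: leq_ltn_trans; rewrite leq_addr.
  by exists k.+1, h'; rewrite pE hE exprSr mulrA.
case: k pE => [|k] pE; last by exists f, k, h.
by rewrite expr0 mulr1 in pE; rewrite -pE fp in nfh.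
Qed.

(** Write the minimal polynomial as h f^(k+1) with f irreducible not
    dividing h, and put g = f^(k+1).  There are a row vector v and a column vector
    psi, both killed by g(A), such that v f^k(A) psi is not 0.  Let R have the rows
    v A^i and S the columns A^j psi, for i, j < deg g.  Then R S is invertible: an
    element of its kernel is a polynomial c of degree less than deg g such that
    v c(A) p(A) psi = 0 for all p, and some multiple of c is f^k modulo g unless
    c = 0.  Hence the cyclic module generated by v has an invariant complement. *)
Lemma split_prime_power n (A : 'M[K]_n) : (0 < n)%N ->
  exists f k m (B : 'M[K]_m), [/\ f \is monic, irreducible_poly f &
    similar_mx A (block_mx (companionmx (f ^+ k.+1)) 0 0 B)].
Proof.
case: n A => // n A _; set mp := mxminpoly A.
have mp0 : mp != 0 by rewrite monic_neq0 ?mxminpoly_monic.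
have mp1 : (1 < size mp)%N by rewrite size_mxminpoly ltnS mxminpoly_nonconstant.
have [f [k [h [fm fI nfh mpE]]]] := exists_prime_power_factor mp1.
have f0 := irredp_neq0 fI; have f1 : (1 < size f)%N by case: fI.
have h0 : h != 0 by apply: contraNneq nfh => ->; rewrite dvdp0.
have Amp : mxhorner A (h * f ^+ k.+1) = 0 by rewrite -mpE; apply: mx_root_minpoly.
have [[u1 u2] /= uE] := Bezout_eq1_coprimepP _ _ (etrans (irreducible_poly_coprime _ fI) nfh).
(* A proper divisor of the minimal polynomial does not kill A. *)
have nz1 : mxhorner A (h * f ^+ k) != 0.
  apply: contraNneq nfh => nz; have := mxminpoly_min nz; rewrite -/mp mpE exprS mulrCA.
  rewrite -{2}[h * _]mul1r dvdp_mul2r ?mulf_neq0 ?expf_neq0 //.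
  by rewrite dvdp1; case: (size f) f1 => [|[]].
have [i [j0 vi0]] := matrix0Pn _ nz1.
pose v := row i (mxhorner A h); pose phi := v *m mxhorner A (f ^+ k).
have phiE : phi = row i (mxhorner A (h * f ^+ k)) by rewrite /phi mxhornerM row_mul.
have vg : v *m mxhorner A (f ^+ k.+1) = 0 by rewrite -row_mul -mxhornerM Amp row0.
have phif : phi *m mxhorner A f = 0 by rewrite -mulmxA -mxhornerM -exprSr.
(* The vector phi = v f^k(A) is killed by f(A), on which h(A) is invertible. *)
have /matrix0Pn[i1 [j wj]] : phi *m mxhorner A h != 0.
  apply: contraNneq vi0 => phih.
  suff /rowP/(_ j0) : phi = 0 by rewrite phiE !mxE => ->.
  rewrite -[phi]mulmx1 -[1%:M](rmorph1 (mxhorner A)) -uE [u1 * _]mulrC [u2 * _]mulrC.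
  by rewrite rmorphD /= mulmxDr !mxhornerM !mulmxA phif phih !mul0mx addr0.
rewrite {i1}ord1 in wj; pose psi := col j (mxhorner A h).
have phipsi : phi *m psi != 0.
  have -> : phi *m psi = col j (phi *m mxhorner A h) by rewrite /psi !colE mulmxA.
  by apply: contraNneq wj => /matrixP/(_ 0 0); rewrite [LHS]mxE [RHS]mxE => ->.
set g := f ^+ k.+1 in vg *; have gm : g \is monic by rewrite monic_exp.
pose R := \matrix_(i < (size g).-1) (v *m mxhorner A 'X^i).
pose S := (\matrix_(i < (size g).-1) (psi^T *m mxhorner A^T 'X^i))^T.
have gpsi : mxhorner A g *m psi = 0.
  by rewrite /psi colE mulmxA -mxhornerM [g * h]mulrC Amp mul0mx.
have vmod p q : g %| p - q -> v *m mxhorner A p = v *m mxhorner A q.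
  case/dvdpP=> w pqE; apply/eqP; rewrite -subr_eq0 -mulmxBr -raddfB /= pqE mulrC.
  by rewrite mxhornerM mulmxA vg mul0mx.
have S0 (u : 'rV_n.+1) : u *m S = 0 -> forall p, u *m mxhorner A p *m psi = 0.
  move=> uS p; rewrite (divp_eq p g) raddfD /= mulmxDr mulmxDl mxhornerM.
  rewrite -!mulmxA gpsi !mulmx0 add0r.
  rewrite -(@poly_rV_K _ (size g).-1 (p %% g)) -?mul_powers_cV ?mulmxA ?uS ?mul0mx //.
  have := ltn_modp p g; rewrite monic_neq0 //.
  by case: (size g).
exists f, k; suff [m [B AB]] : exists m (B : 'M[K]_m),
  similar_mx A (block_mx (companionmx g) 0 0 B) by exists m, B.
apply: (@split_stable _ _ _ _ R S).
- apply: eq_mulmx_rV => u; rewrite !mulmxA !mul_rV_powers -mulmxA.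
  rewrite -{2}[A]mxhornerX -mxhornerM; apply/esym/vmod; exact: companion_mulX.
- apply/rV_subP => x /submxP[y ->]; rewrite mulmxA sub_kermx.
  have /S0 yS : (y *m kermx S) *m S = 0 by rewrite -mulmxA mulmx_ker mulmx0.
  move: (y *m kermx S) yS => z zS.
  apply/eqP/trmx_inj; apply: eq_mulmx_rV => c; rewrite trmx0 mulmx0; apply: trmx_inj.
  rewrite trmx_mul trmxK trmx0 -(mulmxA _ S) mul_powers_cV.
  by rewrite -{1}[A]mxhornerX mulmxA -(mulmxA z) -mxhornerM zS.
- apply: inj_row_free => c; rewrite mulmxA mul_rV_powers => /S0 cS.
  apply/eqP; rewrite -rVpoly_eq0; apply: contraT => q0.
  have [|p pE] := @dvdp_irreducible_exp_bezout f k (rVpoly c) fI.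
    by apply/negP => /(dvdp_leq q0); rewrite leqNgt size_rVpoly_lt ?monic_neq0.
  case/eqP: phipsi; rewrite /phi -(vmod _ _ pE) mxhornerM mulmxA; exact: cS.
Qed.

(** * Elementary divisors *)

Fixpoint bdiag_dim (s : seq {poly K}) : nat :=
  if s is g :: s' then ((size g).-1 + bdiag_dim s')%N else 0%N.

Fixpoint bdiag (s : seq {poly K}) : 'M[K]_(bdiag_dim s) :=
  if s is g :: s' then block_mx (companionmx g) 0 0 (bdiag s') else 0.

Lemma bdiag_dimE s : bdiag_dim s = \sum_(g <- s) (size g).-1.
Proof. by elim: s => [|g s IH]; rewrite ?big_nil ?big_cons //= IH. Qed.

Lemma corank_bdiag s p : all (fun g => g \is monic) s ->
  corank (bdiag s) p = \sum_(g <- s) (size (gcdp p g)).-1.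
Proof.
elim: s => [|g s IH] /= => [_|/andP[gm sm]]; first by rewrite big_nil /corank sub0n.
by rewrite big_cons corank_block corank_companion // IH.
Qed.

(** Adjacent blocks can be exchanged. *)
Lemma similar_bdiag_perm s t : perm_eq s t -> similar_mx (bdiag s) (bdiag t).
Proof.
elim: s t => [|g s IH] t st.
  by move: (perm_size st); case: t {st} => // _; apply: similar_mx_refl.
have gt : g \in t by rewrite -(perm_mem st) mem_head.
case/splitPr: gt st => t1 t2; rewrite perm_sym perm_catC /= perm_cons perm_catC perm_sym.
move/IH => st; have {}st := similar_mx_block (similar_mx_refl (companionmx g)) st.
apply: similar_mx_trans st _.
elim: t1 => [|h t1 IH1] /=; first exact: similar_mx_refl.
apply: similar_mx_trans (similar_mx_swap _ _ _) _.
exact: similar_mx_block (similar_mx_refl _) IH1.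
Qed.

Definition eldiv_poly (x : {poly K} * nat) := x.1 ^+ x.2.

(** Lists of pairs (f, k) such that f^k is a power of a monic irreducible
    polynomial; as multisets these are the possible families of elementary divisors. *)
Definition eldivs (s : seq ({poly K} * nat)) :=
  forall x, x \in s -> [/\ x.1 \is monic, irreducible_poly x.1 & (0 < x.2)%N].

Definition bdiag_eldivs s := bdiag (map eldiv_poly s).

Lemma eldivs_cons x s : [/\ x.1 \is monic, irreducible_poly x.1 & (0 < x.2)%N] ->
  eldivs s -> eldivs (x :: s).
Proof. by move=> xP sP y; rewrite inE => /predU1P[->|/sP]. Qed.

Lemma eldivs_monic s : eldivs s -> all (fun g => g \is monic) (map eldiv_poly s).
Proof.
by move=> sP; apply/allP => _ /mapP[x /sP[xm _ _] ->]; rewrite monic_exp.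
Qed.

(** Existence part of the theorem on elementary divisors, by repeatedly splitting
    off a summand. *)
Lemma exists_eldivs n (A : 'M[K]_n) :
  exists2 s, eldivs s & similar_mx A (bdiag_eldivs s).
Proof.
have [m] := ubnP n; elim: m n A => // m IH n A ltnm.
have [n0|n0] := posnP n.
  exists [::] => //; rewrite n0 in A *; exists 0, 0.
  by split; apply/matrixP => -[].
have [f [k [l [B [fm fI AB]]]]] := split_prime_power A n0.
have f1 : (1 < size f)%N by case: fI.
have := similar_mx_dim AB; rewrite size_exp => nE.
have [|s sP Bs] := IH l B.
  by case: (size f) f1 nE => [|[|d]] // _ /= nE; move: ltnm; rewrite nE mulSn; lia.
exists ((f, k.+1) :: s); first exact: eldivs_cons.
exact: similar_mx_trans AB (similar_mx_block (similar_mx_refl _) Bs).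
Qed.

Lemma size_gcdp_irreducible_exp f g k l : f \is monic -> g \is monic ->
  irreducible_poly f -> irreducible_poly g ->
  (size (gcdp (f ^+ l) (g ^+ k))).-1 =
    if g == f then ((size f).-1 * minn l k)%N else 0%N.
Proof.
move=> fm gm fI gI; have [->|gf] := eqVneq g f.
  have [lk|/ltnW kl] := leqP l k.
    by rewrite (eqp_size (dvdp_gcd_idl _)) ?dvdp_exp2l // size_exp.
  by rewrite (eqp_size (dvdp_gcd_idr _)) ?dvdp_exp2l // size_exp.
have /eqP -> // : coprimep (f ^+ l) (g ^+ k).
apply/coprimep_expl/coprimep_expr; rewrite irreducible_poly_coprime //.
by apply: contra gf => gf; rewrite -(monic_irreducible_eq gm fm gI fI gf).
Qed.

Lemma corank_eldivs s f l : eldivs s -> f \is monic -> irreducible_poly f ->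
  corank (bdiag_eldivs s) (f ^+ l) =
    ((size f).-1 * \sum_(x <- s | x.1 == f) minn l x.2)%N.
Proof.
move=> sP fm fI; rewrite corank_bdiag ?eldivs_monic // big_map big_distrr /=.
rewrite [RHS]big_mkcond /= big_seq [RHS]big_seq; apply: eq_bigr => x /sP[xm xI _].
exact: size_gcdp_irreducible_exp.
Qed.

(** The multiplicity of (f, k + 1) is, up to sign, a second difference of the
    sums that occur in [corank_eldivs]. *)
Lemma count_eldivs (s : seq ({poly K} * nat)) f k :
  (count_mem (f, k.+1) s + \sum_(x <- s | x.1 == f) minn k x.2
    + \sum_(x <- s | x.1 == f) minn k.+2 x.2)%N =
  (2 * \sum_(x <- s | x.1 == f) minn k.+1 x.2)%N.
Proof.
elim: s => [|[g j] s IH] /=; first by rewrite !big_nil.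
rewrite !big_cons /= -[_ == (f, _)]/((_ == _) && (_ == _)) /=.
case: (g == f) => /=; last by [].
move: IH; move: (count _ s) (\sum_(_ <- s | _) _)%N (\sum_(_ <- s | _) _)%N => a b c.
move: (\sum_(_ <- s | _) _)%N => d IH.
have := minn_second_difference k j.
by move: (minn _ _) (minn _ _) (minn _ _) => x y z; lia.
Qed.

(** Coranks determine multiplicities by [count_eldivs]. *)
Lemma eldivs_uniq s t : eldivs s -> eldivs t ->
  (forall f l, f \is monic -> irreducible_poly f ->
    corank (bdiag_eldivs s) (f ^+ l) = corank (bdiag_eldivs t) (f ^+ l)) ->
  perm_eq s t.
Proof.
move=> sP tP E; apply/allP => -[f [|k]]; rewrite mem_cat => x_st.
  by case/orP: x_st => [/sP|/tP] [].
have [fm fI] : f \is monic /\ irreducible_poly f by case/orP: x_st => [/sP|/tP] [].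
have {}E l : (\sum_(x <- s | x.1 == f) minn l x.2 = \sum_(x <- t | x.1 == f) minn l x.2)%N.
  have := E f l fm fI; rewrite !corank_eldivs // => /eqP; rewrite eqn_mul2l.
  by case: fI => f1 _; case: (size f) f1 => [|[|d]] //= _ /eqP.
apply/eqP => /=; have := count_eldivs s f k; have := count_eldivs t f k.
by rewrite !E => <- /addIn /addIn.
Qed.

Lemma similar_mx_corankP m n (A : 'M[K]_m) (B : 'M[K]_n) :
  (forall f l, f \is monic -> irreducible_poly f ->
     corank A (f ^+ l) = corank B (f ^+ l)) -> similar_mx A B.
Proof.
move=> AB; have [s sP As] := exists_eldivs A; have [t tP Bt] := exists_eldivs B.
apply: (similar_mx_trans As); apply: similar_mx_trans (similar_mx_sym Bt).
apply/similar_bdiag_perm/perm_map/eldivs_uniq => // f l fm fI.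
by rewrite -(similar_mx_corank _ As) -(similar_mx_corank _ Bt) AB.
Qed.

Lemma similar_eldivsP s t : eldivs s -> eldivs t ->
  similar_mx (bdiag_eldivs s) (bdiag_eldivs t) <-> perm_eq s t.
Proof.
move=> sP tP; split=> [st|/(perm_map eldiv_poly)/similar_bdiag_perm //].
by apply: eldivs_uniq => // f l _ _; apply: similar_mx_corank.
Qed.

End Matrices.

(** * Powers in terms of elementary divisors *)

Section PowerClasses.
Variable F : finFieldType.
Implicit Types f g h p : {poly F}.

Definition Phi_eldivs (s : seq ({poly F} * nat)) :=
  forall x, x \in s -> Phi x.1 /\ (0 < x.2)%N.

Lemma Phi_eldivsW s : Phi_eldivs s -> eldivs s.
Proof. by move=> sP x /sP[[]]. Qed.

Lemma Phi_comp_deg_dvd f g M : Phi f -> Phi g -> g %| f \Po 'X^M ->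
  ((size f).-1 %| (size g).-1)%N.
Proof.
move=> fP gP gf; have [_ fI _] := fP; have [_ gI _] := gP.
rewrite -Phi_dvdp_Xn_sub1 // (dvdp_comp_order _ gI fI gf).
apply: dvdp_trans (dvdp_Xn_sub1 _ (dvdn_mull _ (dvdnn _))).
by rewrite Phi_dvdp_Xn_sub1.
Qed.

(** As f(X^M) is squarefree, it is g times a polynomial prime to g when
    g divides it.  This f may be X: then no g of Phi divides X^M. *)
Lemma size_gcdp_comp_exp f g k l M : (0 < M)%N -> coprime #|F| M ->
  f \is monic -> irreducible_poly f -> Phi g ->
  (size (gcdp ((f ^+ l) \Po 'X^M) (g ^+ k))).-1 =
    if g %| f \Po 'X^M then ((size g).-1 * minn l k)%N else 0%N.
Proof.
move=> M0 cM fm fI gP; have [gm gI _] := gP; rewrite rmorphXn /=.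
have [gf|ngf] := boolP (g %| f \Po 'X^M); last first.
  have /eqP -> // : coprimep ((f \Po 'X^M) ^+ l) (g ^+ k).
  by apply/coprimep_expl/coprimep_expr; rewrite coprimep_sym irreducible_poly_coprime.
have fP : Phi f.
  split=> //; apply: contraTneq gf => ->; rewrite comp_polyX.
  rewrite -irreducible_poly_coprime //; exact/coprimep_expr/Phi_coprimeX.
have [h fE] := dvdpP _ _ gf.
have hg : coprimep h g.
  by apply: (separable_coprime (Phi_comp_separable fP cM)); rewrite fE.
rewrite fE exprMn (eqp_size (gcdpC _ _)) (eqp_size (Gauss_gcdpr _ _)); last first.
  by apply/coprimep_expl/coprimep_expr; rewrite coprimep_sym.
by rewrite (eqp_size (gcdpC _ _)) size_gcdp_irreducible_exp // eqxx.
Qed.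

Lemma corank_bdiag_exp t f l M : (0 < M)%N -> coprime #|F| M -> Phi_eldivs t ->
  f \is monic -> irreducible_poly f ->
  corank (bdiag_eldivs t ^+ M) (f ^+ l) =
  (\sum_(x <- t | (x.1 %| f \Po 'X^M)%R) (size x.1).-1 * minn l x.2)%N.
Proof.
move=> M0 cM tP fm fI; rewrite corank_exp corank_bdiag ?eldivs_monic //; last exact: Phi_eldivsW.
rewrite big_map [RHS]big_mkcond /= big_seq [RHS]big_seq; apply: eq_bigr => x /tP[xP _].
exact: size_gcdp_comp_exp.
Qed.

Lemma irreducible_factor_monic f M g : (0 < M)%N -> Phi f ->
  irreducible_poly g -> g %| f \Po 'X^M ->
  exists g', [/\ Phi g', g' %| f \Po 'X^M & size g' = size g].
Proof.
move=> M0 fP gI gf; have g0 := irredp_neq0 gI.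
have lc0 : (lead_coef g)^-1 != 0 by rewrite invr_eq0 lead_coef_eq0.
exists ((lead_coef g)^-1 *: g); rewrite size_scale // dvdpZl //; split=> //.
apply: (Phi_factor_comp M0 fP); rewrite ?dvdpZl //.
  by rewrite monicE lead_coefZ mulVf ?lead_coef_eq0.
case: gI => g1 gI; split=> [|h h1]; rewrite ?size_scale // dvdpZr // => /(gI _ h1).
by rewrite (eqp_rtrans (eqp_scale g lc0)).
Qed.

Variables (r a : nat).
Hypotheses (r_prime : prime r) (cM : coprime #|F| (r ^ a)).
Local Notation M := (r ^ a)%N.

Let M_gt0 : (0 < M)%N. Proof. by rewrite expn_gt0 prime_gt0. Qed.

(** The condition on f that is counted by N_M^i(q, d), d being the degree of f. *)
Definition has_inertia f i :=
  if i == 0%N then exists g, [/\ irreducible_poly g, g %| f \Po 'X^M & size g = size f]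
  else forall g, irreducible_poly g -> g %| f \Po 'X^M ->
         size g = ((size f).-1 * r ^ i).+1.

(** Meaningful for f in Phi, where exactly one such i exists. *)
Definition inertia f := xget 0%N [set i | (i <= a)%N /\ has_inertia f i]%classic.

Lemma has_inertia_uniq f i j : Phi f ->
  has_inertia f i -> has_inertia f j -> i = j.
Proof.
move=> fP; have sf0 : (0 < (size f).-1)%N by case: (size f) (Phi_size fP) => [|[]].
have [g gP gf] := exists_Phi_factor_comp a r_prime fP; have [_ gI _] := gP.
(* Inertia 0 excludes any other one: the factor of degree deg f is too small. *)
have noj j' : j' != 0%N -> has_inertia f 0 -> has_inertia f j' -> False.
  rewrite /has_inertia /= => /negPf j0 [h [hI hf hs]]; rewrite j0 => /(_ h hI hf).
  rewrite hs -{1}(@prednK (size f)) ?(ltnW (Phi_size fP)) // => -[] /eqP.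
  rewrite -{1}[X in X == _]muln1 eqn_pmul2l // -{1}(expn0 r) eqn_exp2l ?prime_gt1 //.
  by rewrite eq_sym j0.
have [->|i0] := eqVneq i 0%N; have [->|j0] := eqVneq j 0%N => // fi fj.
- by case: (noj _ j0 fi fj).
- by case: (noj _ i0 fj fi).
move: fi fj; rewrite /has_inertia (negPf i0) (negPf j0).
move=> /(_ g gI gf) E /(_ g gI gf); rewrite E => -[] /eqP.
by rewrite eqn_pmul2l // eqn_exp2l ?prime_gt1 // => /eqP.
Qed.

Lemma inertiaP f : Phi f ->
  (inertia f <= a)%N /\ has_inertia f (inertia f).
Proof.
move=> fP; rewrite /inertia.
apply: (@xgetPex _ 0%N [set i | (i <= a)%N /\ has_inertia f i]%classic).
have [[g [gP gf gs]]|[i /andP[i0 ia] fi]] := Phi_factor_degree a r_prime fP.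
  by exists 0%N; split=> //; exists g; split=> //; case: gP.
exists i; split=> //; rewrite /has_inertia gtn_eqF // => g gI gf.
have [g' [g'P g'f <-]] := irreducible_factor_monic M_gt0 fP gI gf.
by rewrite -(fi g') // prednK // ltnW // Phi_size.
Qed.

Lemma inertiaE f i : Phi f -> (i <= a)%N ->
  inertia f = i <-> has_inertia f i.
Proof.
move=> fP ia; have [_ fr] := inertiaP fP.
by split=> [<- //|fi]; apply: has_inertia_uniq fr fi.
Qed.

(** The quotient r^i of degrees is attained, for every value of the inertia i. *)
Lemma inertia_exists f : Phi f ->
  exists g, [/\ Phi g, g %| f \Po 'X^M &
    (size g).-1 = ((size f).-1 * r ^ inertia f)%N].
Proof.
move=> fP; have [_] := inertiaP fP; rewrite /has_inertia.
case: eqVneq => [-> [g [gI gf gs]]|_ fr].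
  have [g' [g'P g'f g's]] := irreducible_factor_monic M_gt0 fP gI gf.
  by exists g'; rewrite g's gs expn0 muln1.
have [g gP gf] := exists_Phi_factor_comp a r_prime fP; have [_ gI _] := gP.
by exists g; rewrite fr.
Qed.

(** For inertia 0, the point is that F[X]/(g) contains a root of f: the class of
    X^M. *)
Lemma inertia_dvd f g : Phi f -> Phi g -> g %| f \Po 'X^M ->
  ((size f).-1 * r ^ inertia f %| (size g).-1)%N.
Proof.
move=> fP gP gf; have [_] := inertiaP fP; rewrite /has_inertia.
case: eqVneq => [-> _|_ fr]; last by have [_ gI _] := gP; rewrite (fr g) /=.
by rewrite expn0 muln1 (Phi_comp_deg_dvd fP gP gf).
Qed.

(** As each f has only one inertia, the two clauses in the definition of
    N_M^i(q, d) become one. *)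
Lemma NM_inertia i d : (i <= a)%N ->
  NM F M r i d = #|[set f : {poly_(d.+1) F} |
     `[< [/\ Phi f, size f = d.+1 & inertia f = i] >]]|.
Proof.
move=> ia; rewrite /NM; have [i0|i0] := eqVneq i 0%N.
  rewrite /N0; apply: eq_card => f; rewrite !inE. apply: asbool_equiv_eq.
  split=> [[fP fs fr]|[fP fs fi]]; last have {fi} fr := (inertiaE fP ia).1 fi.
    by split=> //; apply/(inertiaE fP ia); rewrite i0 /has_inertia eqxx fs.
  by move: fr; rewrite i0 /has_inertia eqxx fs => fr; split.
rewrite /Npos; apply: eq_card => f; rewrite !inE. apply: asbool_equiv_eq.
split=> [[fP fs fr]|[fP fs fi]]; last have {fi} fr := (inertiaE fP ia).1 fi.
  by split=> //; apply/(inertiaE fP ia); rewrite /has_inertia (negPf i0) fs.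
by move: fr; rewrite /has_inertia (negPf i0) fs => fr; split.
Qed.

(** The elementary divisors of an M-th power are the lists of this form: each (f, k)
    is repeated r^i times, i being the inertia of f. *)
Definition inflate (s : seq ({poly F} * nat)) :=
  flatten [seq nseq (r ^ inertia x.1) x | x <- s].

Lemma big_inflate s (P : pred ({poly F} * nat)) (W : {poly F} * nat -> nat) :
  (\sum_(x <- inflate s | P x) W x = \sum_(x <- s | P x) r ^ inertia x.1 * W x)%N.
Proof.
elim: s => [|x s IH]; first by rewrite !big_nil.
rewrite big_cons -IH /inflate /= big_cat /=.
rewrite sum_nseq.
by case: ifP.
Qed.

Lemma count_inflate s x :
  count_mem x (inflate s) = (r ^ inertia x.1 * count_mem x s)%N.
Proof.
rewrite -!sum1_count big_inflate big_distrr /=.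
by apply: eq_bigr => y /eqP ->.
Qed.

Lemma Phi_eldivs_inflate s : Phi_eldivs s -> Phi_eldivs (inflate s).
Proof.
move=> sP x /flattenP[_ /mapP[y ys ->]]; rewrite mem_nseq => /andP[_ /eqP ->].
exact: sP.
Qed.

(** The second difference of the coranks of f(B^M)^l is, on the one hand, deg f
    times the multiplicity of (f, k) in B^M and, on the other hand, the sum of deg g over
    the elementary divisors (g, k) of B with g | f(X^M).  All these deg g are multiples of
    deg f * r^i. *)
Lemma eldivs_exp_count s t : Phi_eldivs s -> Phi_eldivs t ->
  similar_mx (bdiag_eldivs t ^+ M) (bdiag_eldivs s) ->
  forall x, x \in s -> (r ^ inertia x.1 %| count_mem x s)%N.
Proof.
move=> sP tP ts x xs; have [fP k0] := sP _ xs; have [fm fI _] := fP.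
case: x xs fP k0 fm fI => f [|k] //= xs fP _ fm fI.
have sf0 : (0 < (size f).-1)%N by case: (size f) (Phi_size fP) => [|[]].
have E l := similar_mx_corank (f ^+ l) ts.
pose N l := (\sum_(y <- s | y.1 == f) minn l y.2)%N.
pose T := [seq y <- t | (y.1 %| f \Po 'X^M)%R].
have {}E l : ((size f).-1 * N l = \sum_(y <- T) (size y.1).-1 * minn l y.2)%N.
  by rewrite big_filter -corank_bdiag_exp // E corank_eldivs //; apply: Phi_eldivsW.
have dT : ((size f).-1 * count_mem (f, k.+1) s =
   \sum_(y <- T) (size y.1).-1 * (y.2 == k.+1))%N.
  have /(congr1 (muln (size f).-1)) := count_eldivs s f k.
  rewrite -/(N k) -/(N k.+1) -/(N k.+2) 2!mulnDr (mulnCA _ 2) !E.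
  have -> : (2 * \sum_(y <- T) (size y.1).-1 * minn k.+1 y.2 =
    \sum_(y <- T) (size y.1).-1 * (y.2 == k.+1) +
    \sum_(y <- T) (size y.1).-1 * minn k y.2 + \sum_(y <- T) (size y.1).-1 * minn k.+2 y.2)%N.
    rewrite big_distrr /= -!big_split /=; apply: eq_bigr => y _.
    by rewrite -!mulnDr mulnCA minn_second_difference.
  by move/addIn/addIn.
rewrite -(dvdn_pmul2l sf0) dT big_seq; apply: dvdn_sum => y.
rewrite mem_filter => /andP[yf /tP[yP _]]; apply: dvdn_mulr.
exact: inertia_dvd.
Qed.

(** A factor g of f(X^M) whose degree is the smallest possible one. *)
Definition inertia_factor f := xget 0 [set g | [/\ Phi g, g %| f \Po 'X^M &
    (size g).-1 = ((size f).-1 * r ^ inertia f)%N]]%classic.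

Lemma inertia_factorP f : Phi f -> [/\ Phi (inertia_factor f),
  inertia_factor f %| f \Po 'X^M &
  (size (inertia_factor f)).-1 = ((size f).-1 * r ^ inertia f)%N].
Proof. by move/inertia_exists/xgetPex => /(_ 0). Qed.

(** Replacing every (f, k) by (g, k), with g the chosen factor of f(X^M), gives
    the elementary divisors of an M-th root: each block (g, k) contributes
    deg g / deg f = r^i copies of (f, k) to the power. *)
Lemma inflate_eldivs_exp s : Phi_eldivs s -> exists2 t, Phi_eldivs t &
  similar_mx (bdiag_eldivs t ^+ M) (bdiag_eldivs (inflate s)).
Proof.
move=> sP; pose t := [seq (inertia_factor x.1, x.2) | x <- s].
have tP : Phi_eldivs t.
  by move=> _ /mapP[x /sP[xP x0] ->]; have [] := inertia_factorP xP.
exists t => //; apply: similar_mx_corankP => f l fm fI.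
rewrite corank_bdiag_exp // corank_eldivs //; last exact/Phi_eldivsW/Phi_eldivs_inflate.
rewrite big_inflate big_map big_distrr /= big_mkcond [RHS]big_mkcond /=.
rewrite big_seq [RHS]big_seq; apply: eq_bigr => x /sP[xP _].
have [gP gx gs] := inertia_factorP xP; have [xm xI _] := xP.
have [<-|xf] := eqVneq x.1 f; first by rewrite gx gs mulnA.
rewrite ifN //; apply: contra xf => gf; apply: contraT => xf.
have : coprimep x.1 f.
  rewrite irreducible_poly_coprime //; apply: contra xf => xf.
  by rewrite (monic_irreducible_eq fm xm fI xI xf).
move/(coprimep_comp_poly 'X^M)/coprimepP/(_ _ gx gf).
by rewrite -size_poly_eq1 gtn_eqF // Phi_size.
Qed.

End PowerClasses.

(** * Conjugacy classes of the general linear group *)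

Section GLClasses.
Variables (F : finFieldType) (n : nat).
Local Notation GL := 'GL_(n.+1)[F]%g.
Implicit Types u v w : {'GL_(n.+1)[F]}.

Lemma GL_XE u k : GLval (u ^+ k)%g = GLval u ^+ k.
Proof. by elim: k => [|k IH] //; rewrite expgS exprS -IH. Qed.

(** Conjugate elements u, v of the group are related by v = w^-1 u w, which is
    the intertwining relation u w = w v. *)
Lemma GL_class_similar u v : (v \in u ^: GL)%g <-> similar_mx (GLval u) (GLval v).
Proof.
split=> [/imsetP[w _ ->]|[P [Q [PQ QP uP]]]].
  exists (GLval w), (GLval w^-1%g); rewrite -!GL_MxE mulgV mulVg.
  by rewrite /conjg mulgA mulgV mul1g.
have uP' : P \is a GRing.unit by have [] := mulmx1_unit PQ.
pose w : {'GL_(n.+1)[F]} := FinRing.unit _ uP'.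
apply/imsetP; exists w; first by rewrite inE.
apply/(mulgI w)/val_inj; rewrite /conjg mulgA mulgV mul1g.
by rewrite [LHS]GL_MxE [RHS]GL_MxE -uP.
Qed.

Lemma GL_corankX u : corank (GLval u) 'X = 0%N.
Proof. by rewrite /corank mxhornerX mxrank_unit ?subnn // GL_unitmx. Qed.

(** X is not an elementary divisor of an invertible matrix, since its corank at X
    is 0. *)
Lemma GL_eldivs u : exists2 s, Phi_eldivs s & similar_mx (GLval u) (bdiag_eldivs s).
Proof.
have [s sP us] := exists_eldivs (GLval u).
exists s => // x xs; have [xm xI x0] := sP x xs; split=> //; split=> //.
apply/negP => /eqP xX.
have := similar_mx_corank ('X ^+ 1) us; rewrite [LHS]GL_corankX.
rewrite corank_eldivs ?monicX //; last exact: irreducible_polyX.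
rewrite size_polyX mul1n (big_rem x) //= xX eqxx.
have : (0 < minn 1 x.2)%N by rewrite leq_min x0.
by case: minn.
Qed.

Lemma eldivs_GL s : Phi_eldivs s -> bdiag_dim (map (@eldiv_poly F) s) = n.+1 ->
  exists u, similar_mx (GLval u) (bdiag_eldivs s).
Proof.
move=> sP sn; have [A As] : exists A : 'M[F]_n.+1, similar_mx A (bdiag_eldivs s).
  by rewrite -sn; exists (bdiag_eldivs s); apply: similar_mx_refl.
suff uA : A \is a GRing.unit by exists (FinRing.unit _ uA).
have := similar_mx_corank ('X ^+ 1) As.
rewrite corank_eldivs ?monicX //; [|exact: Phi_eldivsW|exact: irreducible_polyX].
rewrite big1_seq => [|x /andP[/eqP xX /sP[[_ _]]]]; last by rewrite xX eqxx.
rewrite muln0 /corank expr1 mxhornerX => /eqP; rewrite subn_eq0 => rA.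
by rewrite -row_full_unit -col_leq_rank.
Qed.

Lemma GL_class_perm u v s t : Phi_eldivs s -> Phi_eldivs t ->
  similar_mx (GLval u) (bdiag_eldivs s) -> similar_mx (GLval v) (bdiag_eldivs t) ->
  (v \in u ^: GL)%g <-> perm_eq s t.
Proof.
move=> sP tP us vt; apply: (iff_trans (GL_class_similar u v)).
apply: iff_trans (similar_eldivsP (Phi_eldivsW sP) (Phi_eldivsW tP)).
split=> [uv|st]; last exact: similar_mx_trans us (similar_mx_trans st (similar_mx_sym vt)).
exact: similar_mx_trans (similar_mx_sym us) (similar_mx_trans uv vt).
Qed.

Lemma GL_class_power u M :
  (u ^: GL \subset [set x ^+ M | x in GL])%g <-> exists v, u = (v ^+ M)%g.
Proof.
split=> [/fintype.subsetP/(_ u (class_refl _ _))/imsetP[v _ ->]|[v ->]]; first by exists v.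
apply/fintype.subsetP => _ /imsetP[w wG ->]; rewrite conjXg.
by apply: imset_f; rewrite inE.
Qed.

End GLClasses.

(** * Counting the classes of powers *)

Section Multisets.
Variables (T : eqType) (I : finType) (f : I -> T).

(** The multiset with multiplicities m, listed with its members relabelled by f. *)
Definition multiset_seq b (m : {ffun I -> 'I_b}) : seq T :=
  flatten [seq nseq (m x) (f x) | x <- enum I].

Lemma sum_multiset_seq b (m : {ffun I -> 'I_b}) (P : pred T) (W : T -> nat) :
  (\sum_(y <- multiset_seq m | P y) W y = \sum_(x | P (f x)) m x * W (f x))%N.
Proof.
rewrite /multiset_seq big_flatten big_map [RHS]big_mkcond -[in RHS]big_enum /=.
by apply: eq_bigr => x _; rewrite sum_nseq.
Qed.

Lemma count_multiset_seq b (m : {ffun I -> 'I_b}) x : injective f ->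
  count_mem (f x) (multiset_seq m) = m x.
Proof.
move=> f_inj; rewrite -sum1_count sum_multiset_seq (big_pred1 x) ?muln1 // => y.
by rewrite /= (inj_eq f_inj).
Qed.

Lemma mem_multiset_seq b (m : {ffun I -> 'I_b}) y :
  y \in multiset_seq m -> exists2 x, y = f x & (0 < m x)%N.
Proof.
case/flattenP=> _ /mapP[x _ ->]; rewrite mem_nseq => /andP[m0 /eqP yE].
by exists x.
Qed.

End Multisets.

Section CountClasses.
Variables (F : finFieldType) (r a n' : nat).
Hypotheses (r_prime : prime r) (cM : coprime #|F| (r ^ a)).
Local Notation n := n'.+1.
Local Notation M := (r ^ a)%N.
Local Notation inert := (inertia r a).

(** In size n only polynomials of degree at most n and exponents at most n can
    occur, whence a finite type of pairs (f, k). *)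
Definition eldiv_index := ({poly_(n.+1) F} * 'I_n.+1)%type.
Definition index_eldiv (x : eldiv_index) : {poly F} * nat := (val x.1, val x.2).
Definition Phi_index (x : eldiv_index) := `[< Phi (val x.1) >] && (0 < x.2)%N.
Definition index_weight (x : eldiv_index) := (x.2 * r ^ inert (val x.1) * (size (val x.1)).-1)%N.

Implicit Type m : {ffun eldiv_index -> 'I_n.+1}.

(** The families of multiplicities m(f, k) of total weight n.  The weight of
    a pair in the support is at least 1, so that no multiplicity exceeds n.  The support condition makes
    m vanish at the pairs that are not elementary divisors. *)
Definition power_class_codes : {set {ffun eldiv_index -> 'I_n.+1}} :=
  [set m in pffun_on ord0 Phi_index predT |
     \sum_(x | Phi_index x) m x * index_weight x == n]%N.

Lemma index_eldiv_inj : injective index_eldiv.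
Proof. by move=> [f k] [g l] [/val_inj-> /val_inj->]. Qed.

Let code_seq (m : {ffun eldiv_index -> 'I_n.+1}) := multiset_seq index_eldiv m.

Lemma power_class_codesP m : reflect
  ((forall x, (0 < m x)%N -> Phi_index x) /\ (\sum_x m x * index_weight x)%N = n)
  (m \in power_class_codes).
Proof.
have sumE : (forall x, (0 < m x)%N -> Phi_index x) ->
    (\sum_(x | Phi_index x) m x * index_weight x = \sum_x m x * index_weight x)%N.
  move=> sm; rewrite big_mkcond; apply: eq_bigr => x _; case: ifPn => // nx.
  by have [->|/sm] := posnP (m x); rewrite ?mul0n // (negPf nx).
rewrite inE; apply: (iffP andP) => [[/pffun_onP[/fintype.subsetP sm _] /eqP nE]|[sm nE]].
  have {}sm x : (0 < m x)%N -> Phi_index x.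
    by move=> m0; apply: sm; rewrite inE -val_eqE /= -lt0n.
  by split=> //; rewrite -sumE.
split; last by rewrite sumE ?nE.
apply/pffun_onP; split=> //; apply/fintype.subsetP => x.
by rewrite inE -val_eqE /= -lt0n; apply: sm.
Qed.

Lemma code_seq_Phi m : m \in power_class_codes -> Phi_eldivs (code_seq m).
Proof.
move/power_class_codesP=> [sm _] y; case/mem_multiset_seq=> x -> m0.
by have /andP[/asboolP xP x0] := sm x m0.
Qed.

Lemma code_seq_dim m : bdiag_dim (map (@eldiv_poly F) (inflate r a (code_seq m))) =
  (\sum_x m x * index_weight x)%N.
Proof.
rewrite bdiag_dimE big_map big_inflate sum_multiset_seq; apply: eq_bigr => x _.
by rewrite size_exp /index_weight /= [(x.2 * _)%N]mulnC -mulnA [(x.2 * _)%N]mulnC.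
Qed.

Definition code_elt m := xget 1%g [set u : {'GL_n[F]} |
  similar_mx (GLval u) (bdiag_eldivs (inflate r a (code_seq m)))]%classic.

Lemma code_eltP m : m \in power_class_codes ->
  similar_mx (GLval (code_elt m)) (bdiag_eldivs (inflate r a (code_seq m))).
Proof.
move=> mD; apply: (@xgetPex _ 1%g [set u : {'GL_n[F]} |
  similar_mx (GLval u) (bdiag_eldivs (inflate r a (code_seq m)))]%classic).
apply: eldivs_GL; first exact/Phi_eldivs_inflate/code_seq_Phi.
by rewrite code_seq_dim; have /power_class_codesP[] := mD.
Qed.

(** Conjugate elements have the same elementary divisors, and all the
    multiplicities of an inflated list are those of the code times a positive number. *)
Lemma code_class_inj :
  {in power_class_codes &, injective (fun m => code_elt m ^: 'GL_n[F])%g}.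
Proof.
move=> m1 m2 m1D m2D /= E; apply/ffunP => x; apply/val_inj => /=.
have st : perm_eq (inflate r a (code_seq m1)) (inflate r a (code_seq m2)).
  apply/(GL_class_perm _ _ (code_eltP m1D) (code_eltP m2D)).
  - exact/Phi_eldivs_inflate/code_seq_Phi.
  - exact/Phi_eldivs_inflate/code_seq_Phi.
  - by rewrite E class_refl.
have := seq.permP st (pred1 (index_eldiv x)).
rewrite !count_inflate !count_multiset_seq; [|exact: index_eldiv_inj..].
by move/eqP; rewrite eqn_pmul2l ?expn_gt0 ?prime_gt0 // => /eqP.
Qed.

Lemma code_class_power m : m \in power_class_codes ->
  exists v, (code_elt m \in (v ^+ M) ^: 'GL_n[F])%g.
Proof.
move=> mD; have [t tP ts] := inflate_eldivs_exp r_prime cM (code_seq_Phi mD).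
have us := code_eltP mD.
have tn : bdiag_dim (map (@eldiv_poly F) t) = n.
  by rewrite (similar_mx_dim ts) (similar_mx_dim us).
have [v vt] := eldivs_GL tP tn; exists v; apply/GL_class_similar; rewrite GL_XE.
apply: similar_mx_trans (similar_mx_sym us).
exact: similar_mx_trans (similar_mx_exp M vt) ts.
Qed.

(** The c copies of (f, k) take up the dimension c k deg f. *)
Lemma eldivs_bounds s x : Phi_eldivs s ->
  bdiag_dim (map (@eldiv_poly F) s) = n -> x \in s ->
  [/\ (size x.1 <= n.+1)%N, (x.2 < n.+1)%N & (count_mem x s < n.+1)%N].
Proof.
move=> sP sn xs; have [xP x0] := sP x xs; have x1 := Phi_size xP.
have : (count_mem x s * ((size x.1).-1 * x.2) <= n)%N.
  rewrite -sn bdiag_dimE big_map -sum1_count big_distrl /= [leqRHS](bigID (pred1 x)) /=.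
  apply: leq_trans (leq_addr _ _); rewrite leq_sum // => y /eqP ->.
  by rewrite size_exp mul1n.
have c0 : (0 < count_mem x s)%N by rewrite -has_count has_pred1.
have d0 : (0 < (size x.1).-1)%N by case: (size x.1) x1 => [|[]].
move=> le; split.
- rewrite -(prednK (ltnW x1)) ltnS; apply: leq_trans le.
  by rewrite mulnCA leq_pmulr // muln_gt0 c0.
- by rewrite ltnS; apply: leq_trans le; rewrite mulnA leq_pmull // muln_gt0 c0.
- by rewrite ltnS; apply: leq_trans le; rewrite leq_pmulr // muln_gt0 d0.
Qed.

(** By [eldivs_exp_count] the multiplicities in a power are divisible by the
    r^i, and the quotients form the code. *)
Lemma power_class_code v : exists2 m, m \in power_class_codes &
  ((v ^+ M)%g \in code_elt m ^: 'GL_n[F])%g.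
Proof.
have [s sP us] := GL_eldivs (v ^+ M)%g; have [t tP vt] := GL_eldivs v.
have sn : bdiag_dim (map (@eldiv_poly F) s) = n by rewrite -(similar_mx_dim us).
have ts : similar_mx (bdiag_eldivs t ^+ M) (bdiag_eldivs s).
  apply: similar_mx_trans us; rewrite GL_XE; apply: similar_mx_exp.
  exact: similar_mx_sym.
have dvd_s x : (r ^ inert x.1 %| count_mem x s)%N.
  have [xs|xs] := boolP (x \in s); first exact: (eldivs_exp_count r_prime cM sP tP ts).
  by rewrite (count_memPn xs) dvdn0.
pose m : {ffun eldiv_index -> 'I_n.+1} :=
  [ffun x => inord (count_mem (index_eldiv x) s %/ r ^ inert (val x.1))].
have mE x : m x = (count_mem (index_eldiv x) s %/ r ^ inert (val x.1))%N :> nat.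
  rewrite ffunE inordK //; apply: leq_ltn_trans (leq_div _ _) _.
  have [xs|xs] := boolP (index_eldiv x \in s); first by have [] := eldivs_bounds sP sn xs.
  by rewrite (count_memPn xs).
have st : perm_eq s (inflate r a (code_seq m)).
  apply/allP => y _; apply/eqP => /=.
  have codeE x : count_mem (index_eldiv x) (inflate r a (code_seq m)) =
      count_mem (index_eldiv x) s.
    rewrite count_inflate count_multiset_seq; last exact: index_eldiv_inj.
    by rewrite mE mulnC; exact: divnK (dvd_s (index_eldiv x)).
  have [ys|ys] := boolP (y \in s).
    have [y1 y2 _] := eldivs_bounds sP sn ys.
    suff <- : index_eldiv (npolyp n.+1 y.1, inord y.2) = y by rewrite codeE.
    by rewrite /index_eldiv /= npolypK // inordK //; case: (y).
  have [yc|yc] := boolP (y \in inflate r a (code_seq m)); last by rewrite !(count_memPn _).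
  have [x yE _] : exists2 x, y = index_eldiv x & (0 < m x)%N.
    case/flattenP: yc => _ /mapP[z zm ->]; rewrite mem_nseq => /andP[_ /eqP ->].
    exact: mem_multiset_seq.
  by rewrite yE codeE.
have mD : m \in power_class_codes.
  apply/power_class_codesP; split=> [x|]; last first.
    rewrite -code_seq_dim -sn; apply/esym; have := similar_bdiag_perm (perm_map (@eldiv_poly F) st).
    exact: similar_mx_dim.
  rewrite mE => m0; have /sP[xP x0] : index_eldiv x \in s.
    by apply: contraTT m0 => xs; rewrite (count_memPn xs) div0n.
  by rewrite /Phi_index x0 andbT; apply/asboolP.
exists m => //; apply/(GL_class_perm _ sP (code_eltP mD) us).
  exact/Phi_eldivs_inflate/code_seq_Phi.
by rewrite perm_sym.
Qed.

Lemma num_power_classesE : num_power_classes F n M = #|power_class_codes|.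
Proof.
rewrite -(card_in_imset code_class_inj); apply: eq_card => C; rewrite !inE.
apply/andP/imsetP => [[/imsetP[u _ ->]]|[m mD ->]].
  move/GL_class_power=> [v uE]; have [m mD vm] := power_class_code v.
  by exists m => //; apply/class_eqP; rewrite uE.
split; first by apply: imset_f; rewrite inE.
have [v vm] := code_class_power mD; rewrite (class_eqP vm).
by apply/GL_class_power; exists v.
Qed.

End CountClasses.

(** * Power series modulo a power of u *)

Section FpsCong.
Variable R : comNzRingType.
Implicit Types (f g h : fps R) (N : nat).

(** Congruence modulo u^N. *)
Definition fps_cong N f g := forall n, (n < N)%N -> coefs f n = coefs g n.

Lemma fps_cong_refl N f : fps_cong N f f. Proof. by []. Qed.

Lemma fps_cong_sym N f g : fps_cong N f g -> fps_cong N g f.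
Proof. by move=> fg n nN; rewrite fg. Qed.

Lemma fps_cong_trans N f g h : fps_cong N f g -> fps_cong N g h -> fps_cong N f h.
Proof. by move=> fg gh n nN; rewrite fg ?gh. Qed.

Lemma fps_cong_leq N N' f g : (N <= N')%N -> fps_cong N' f g -> fps_cong N f g.
Proof. by move=> NN fg n nN; rewrite fg // (leq_trans nN). Qed.

Lemma fps_congM N f g f' g' :
  fps_cong N f g -> fps_cong N f' g' -> fps_cong N (f * f') (g * g').
Proof.
move=> fg fg' n nN; apply: eq_bigr => i _.
by rewrite fg ?fg' // (leq_ltn_trans _ nN) ?leq_subr // -ltnS.
Qed.

Lemma fps_cong_prod N (I : Type) (s : seq I) (P : pred I) (G H : I -> fps R) :
  (forall i, P i -> fps_cong N (G i) (H i)) ->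
  fps_cong N (\prod_(i <- s | P i) G i) (\prod_(i <- s | P i) H i).
Proof.
move=> GH; apply: (big_ind2 (fps_cong N)) => // f g f' g'.
exact: fps_congM.
Qed.

Lemma fps_cong_prod1 N (I : Type) (s : seq I) (P : pred I) (G : I -> fps R) :
  (forall i, P i -> fps_cong N (G i) 1) -> fps_cong N (\prod_(i <- s | P i) G i) 1.
Proof.
by move=> G1; have := @fps_cong_prod N I s P G (fun=> 1) G1; rewrite big1_eq.
Qed.

Lemma fps_congV N f g : f \is a GRing.unit -> fps_cong N (f * g) 1 ->
  fps_cong N f^-1 g.
Proof.
move=> uf fg; apply: fps_cong_sym.
by have := fps_congM (@fps_cong_refl N f^-1) fg; rewrite mulKr // mulr1.
Qed.

Lemma fps_cong_1BXn k : fps_cong k (1 - fpsXn R k) 1.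
Proof. by move=> n nk /=; rewrite (ltn_eqF nk) subr0. Qed.

Lemma fps_cong_inv_1BXn k e : (0 < k)%N -> fps_cong k ((1 - fpsXn R k) ^- e) 1.
Proof.
move=> k0; apply: fps_congV; first by rewrite unitrX ?fps_unit1BXn.
rewrite mulr1 -[e]card_ord -prodr_const; apply: fps_cong_prod1 => i _.
exact: fps_cong_1BXn.
Qed.

(** Factors of index greater than n are 1 modulo u^(n+1), so that they no longer
    affect the coefficient of u^n. *)
Lemma infprod_cong (G : nat -> fps R) :
    (forall k, (0 < k)%N -> fps_cong k (G k) 1) ->
  cvg_infprod G /\
  forall n, fps_cong n.+1 (infprod G) (\prod_(1 <= k < n.+1) G k).
Proof.
move=> G1; pose P := Fps (fun n => coefs (\prod_(1 <= k < n.+1) G k) n).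
have PE n K : (n <= K)%N -> coefs (\prod_(1 <= k < K.+1) G k) n = coefs P n.
  move=> nK; rewrite (big_cat_nat _ (_ : n.+1 <= K.+1)%N) //=.
  rewrite -[in RHS](mulr1 (\prod_(_ <= _ < _) _)).
  apply: (@fps_congM n.+1) => //; rewrite big_nat; apply: fps_cong_prod1 => k /andP[nk _].
  by apply: (fps_cong_leq nk); apply: G1; apply: leq_trans nk.
have GP : cvg_infprod_to G P by move=> n; exists n => K; apply: PE.
split; first by exists P.
by move=> n l ln; rewrite (infprodE GP) PE.
Qed.

Lemma fpsXnD k l : fpsXn R k * fpsXn R l = fpsXn R (k + l).
Proof.
apply: fpsP => n /=; have [ltnk|lekn] := ltnP n k.
  rewrite big1 => [|i _]; first by rewrite ltn_eqF // (leq_trans ltnk) ?leq_addr.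
  by rewrite ltn_eqF ?mul0r // (leq_trans (ltn_ord i)).
rewrite (bigD1 (Ordinal (lekn : (k < n.+1)%N))) //= eqxx mul1r.
rewrite big1 ?addr0 => [|i]; last by rewrite -val_eqE /= => /negPf ->; rewrite mul0r.
by rewrite -(eqn_add2l k) subnKC.
Qed.

Lemma fpsXn_exp k m : fpsXn R k ^+ m = fpsXn R (k * m).
Proof. by elim: m => [|m IH]; rewrite ?muln0 // exprS IH fpsXnD mulnS. Qed.

Lemma prod_fpsXn (I : Type) (s : seq I) (P : pred I) (w : I -> nat) :
  \prod_(i <- s | P i) fpsXn R (w i) = fpsXn R (\sum_(i <- s | P i) w i).
Proof.
by apply: (big_ind2 (fun f k => f = fpsXn R k)) => // f k g l -> ->; rewrite fpsXnD.
Qed.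

Lemma coefs_sum n (I : Type) (s : seq I) (P : pred I) (G : I -> fps R) :
  coefs (\sum_(i <- s | P i) G i) n = \sum_(i <- s | P i) coefs (G i) n.
Proof. by apply: (big_morph (fun f => coefs f n)). Qed.

(** Modulo u^(n+1), the geometric series of ratio u^k may be cut after n + 1
    terms. *)
Lemma geometric_cong k n : (0 < k)%N ->
  fps_cong n.+1 (1 - fpsXn R k)^-1 (\sum_(m < n.+1) fpsXn R (m * k)).
Proof.
move=> k0; apply: fps_congV; first exact: fps_unit1BXn.
have -> : \sum_(m < n.+1) fpsXn R (m * k) = \sum_(m < n.+1) fpsXn R k ^+ m.
  by apply: eq_bigr => m _; rewrite fpsXn_exp mulnC.
have -> : (1 - fpsXn R k) * \sum_(m < n.+1) fpsXn R k ^+ m = 1 - fpsXn R (k * n.+1).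
  by rewrite -fpsXn_exp -opprB mulNr -subrX1 opprB.
by apply: fps_cong_leq (@fps_cong_1BXn _); rewrite leq_pmull.
Qed.

(** Expand the product of the truncated geometric series: a choice of one
    term in each of them is a family m of multiplicities, and contributes u to the total
    weight of m. *)
Lemma coefs_prod_geometric (I : finType) (P : pred I) (w : I -> nat) n :
    (forall i, P i -> (0 < w i)%N) ->
  coefs (\prod_(i | P i) (1 - fpsXn R (w i))^-1) n =
  #|[set m in pffun_on (@ord0 n) P predT | \sum_(i | P i) m i * w i == n]%N|%:R.
Proof.
move=> w0; rewrite (@fps_cong_prod n.+1 _ _ _ _
  (fun i => \sum_(m < n.+1) fpsXn R (m * w i))) //; last first.
  by move=> i Pi; apply: geometric_cong; apply: w0.
rewrite (big_distr_big ord0) coefs_sum -sum1_card natr_sum.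
rewrite [RHS](eq_bigl (fun m => (m \in pffun_on (@ord0 n) P predT) && 
   (\sum_(i | P i) m i * w i == n)%N)); last by move=> m; rewrite inE.
rewrite big_mkcondr /=; apply: eq_bigr => m _.
by rewrite prod_fpsXn /= eq_sym; case: eqP.
Qed.

End FpsCong.

(** * The generating function *)

Section Assembly.
Variables (F : finFieldType) (r a : nat).
Hypothesis r_prime : prime r.
Local Notation M := (r ^ a)%N.
Local Notation inert := (inertia r a).

Lemma card_npoly_widen d n (Q : pred {poly F}) : (d <= n)%N ->
  (forall f, Q f -> (size f <= d)%N) ->
  #|[set f : {poly_d F} | Q f]| = #|[set f : {poly_n F} | Q f]|.
Proof.
move=> dn Qd; pose w (f : {poly_d F}) : {poly_n F} := npolyp n f.
have wE f : w f = f :> {poly F} by rewrite npolypK // (leq_trans (size_npoly f)).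
have w_inj : injective w by move=> f g fg; apply/val_inj; rewrite /= -wE fg wE.
rewrite -(card_imset _ w_inj); apply: eq_card => f; rewrite inE.
apply/imsetP/idP => [[g gQ ->]|fQ]; first by rewrite inE in gQ; rewrite wE.
have fE : npolyp d f = f :> {poly F} by rewrite npolypK // Qd.
by exists (npolyp d f); [rewrite inE fE|apply/val_inj; rewrite /= wE fE].
Qed.

(** Group the polynomials by inertia and degree. *)
Lemma prod_Phi (S : comNzRingType) n (h : nat -> nat -> S) :
  \prod_(f : {poly_(n.+1) F} | `[< Phi f >]) h (inert f) (size f).-1 =
  \prod_(0 <= i < a.+1) \prod_(1 <= d < n.+1) h i d ^+ NM F M r i d.
Proof.
rewrite big_mkord; under [RHS]eq_bigr do rewrite big_geq_mkord.
rewrite pair_big /=.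
have szf (f : {poly_(n.+1) F}) : Phi f -> (0 < (size f).-1 < n.+1)%N.
  move=> /Phi_size f1; have := size_npoly f.
  by case: (size f) f1 => [|[|l]].
rewrite (partition_big
  (fun f : {poly_(n.+1) F} => (inord (inert f) : 'I_a.+1, inord (size f).-1 : 'I_n.+1))
  (fun p => (0 < p.2)%N)) /=; last first.
  by move=> f /asboolP/szf/andP[f0 fn]; rewrite inordK.
apply: eq_bigr => -[i d] /= d0.
have ia : (i <= a)%N by rewrite -ltnS.
have fE (f : {poly_(n.+1) F}) : `[< Phi f >] && ((inord (inert f), inord (size f).-1) == (i, d)) =
    `[< [/\ Phi f, size f = d.+1 & inert f = i] >].
  apply/andP/asboolP => [[/asboolP fP /eqP[fi fd]]|[fP fs fi]].
    have /andP[f0 fn] := szf f fP; have [ra _] := inertiaP a r_prime fP.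
    split=> //; last by rewrite -fi inordK.
    by rewrite -fd inordK // prednK // ltnW // Phi_size.
  by split; [exact/asboolP|rewrite fs fi /= !inord_val].
rewrite (eq_bigl _ _ fE) (eq_bigr (fun=> h i d)) => [|f /asboolP[_ -> ->] //].
rewrite prodr_const (NM_inertia _ r_prime _ ia); congr (_ ^+ _).
rewrite (@card_npoly_widen d.+1 n.+1
  (fun f => `[< [/\ Phi f, size f = d.+1 & inert f = i] >])) //.
  by apply: eq_card => f; rewrite inE.
by move=> f /asboolP[_ ->].
Qed.

Lemma prod_Phi_index n' (n := n'.+1) :
  \prod_(1 <= j < n.+1) \prod_(0 <= i < a.+1) \prod_(1 <= d < n.+1)
    (1 - fpsXn int (j * r ^ i * d)) ^- NM F M r i d =
  \prod_(x | @Phi_index F n' x) (1 - fpsXn int (index_weight r a x))^-1.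
Proof.
rewrite big_geq_mkord.
transitivity (\prod_(k < n.+1 | (0 < k)%N) \prod_(f : {poly_(n.+1) F} | `[< Phi f >])
   (1 - fpsXn int (k * r ^ inert f * (size f).-1))^-1).
  apply: eq_bigr => j _; rewrite (prod_Phi n (fun i d => (1 - fpsXn int (j * r ^ i * d))^-1)).
  by apply: eq_bigr => i _; apply: eq_bigr => d _; rewrite exprVn.
by rewrite exchange_big pair_big.
Qed.

End Assembly.

Theorem theorem7p5 (r a q : nat) (F : finFieldType)
    (r_prime : prime r) (a_ge1 : (1 <= a)%N) (card_F : #|F| = q)
    (q_coprime : coprime q (r ^ a)) :
  let factor (j i d : nat) : fps int :=
    (1 - fpsXn int (j * r ^ i * d)) ^- NM F (r ^ a) r i d in
  let inner (j i : nat) : fps int := infprod (factor j i) in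
  let outer (j : nat) : fps int := \prod_(0 <= i < a.+1) inner j i in
  [/\ forall j i, (1 <= j)%N -> (i <= a)%N -> cvg_infprod (factor j i),
      cvg_infprod outer &
      power_class_series F (r ^ a) = infprod outer].
Proof.
move=> factor inner outer; rewrite -card_F in q_coprime.
have r0 : (0 < r)%N by apply: prime_gt0.
have factor1 j i d : (0 < j)%N -> (0 < d)%N -> fps_cong (j * d) (factor j i d) 1.
  move=> j0 d0; have w0 : (0 < j * r ^ i * d)%N by rewrite !muln_gt0 j0 expn_gt0 r0.
  apply: fps_cong_leq (fps_cong_inv_1BXn _ _ w0).
  by rewrite mulnAC leq_pmulr // expn_gt0 r0.
have innerP j i : (0 < j)%N -> cvg_infprod (factor j i) /\
    forall n, fps_cong n.+1 (inner j i) (\prod_(1 <= d < n.+1) factor j i d).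
  move=> j0; apply: infprod_cong => d d0.
  by apply: fps_cong_leq (factor1 _ _ _ j0 d0); rewrite leq_pmull.
have inner1 j i : (0 < j)%N -> fps_cong j (inner j i) 1.
  case: j => // j j0; have [_ /(_ j) cj] := innerP j.+1 i j0.
  apply: fps_cong_trans cj _; rewrite big_nat; apply: fps_cong_prod1 => d /andP[d0 _].
  by apply: fps_cong_leq (factor1 _ _ _ j0 d0); rewrite leq_pmulr.
have outerP : cvg_infprod outer /\
    forall n, fps_cong n.+1 (infprod outer) (\prod_(1 <= j < n.+1) outer j).
  by apply: infprod_cong => j j0; apply: fps_cong_prod1 => i _; apply: inner1.
split; [by move=> j i /(innerP j i)[]|by case: outerP|].
have [_ outerE] := outerP; apply: fpsP => -[|n] /=.
  by rewrite (outerE 0%N) // big_geq.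
rewrite (outerE n.+1) // big_nat (@fps_cong_prod _ n.+2 _ _ _ _
  (fun j => \prod_(0 <= i < a.+1) \prod_(1 <= d < n.+2) factor j i d)) //; last first.
  move=> j /andP[j0 _]; apply: fps_cong_prod => i _.
  by have [_] := innerP j i j0; apply.
rewrite -big_nat prod_Phi_index // coefs_prod_geometric; last first.
  move=> x /andP[/asboolP/Phi_size x1 x0].
  rewrite !muln_gt0 x0 expn_gt0 r0 /=.
  by case: size x1 => [|[]].
by rewrite num_power_classesE // natz.
Qed.
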